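(* Let $n\ge 1$, $G=\mathbb Z/n\mathbb Z$ (elements written $\bar k$, $k\in\mathbb Z$), let $\omega$ be a normalized $3$-cocycle of $G$ with values in $\mathbb F^\times$, and let $\mathcal M(X,\Psi_X)$, $\mathcal M(Y,\Psi_Y)$ be module categories over $\mathrm{Vec}_G^\omega$ with $X,Y$ finite $G$-sets. For each orbit $\Gamma$ of $X\times Y$ under the diagonal action $g\cdot(x,y)=(g\cdot x,g\cdot y)$, fix $(x,y)\in\Gamma$, put $r:=|\Gamma|$ and $$\gamma_{x,y}=\prod_{t=1}^{n-1}\Psi_X^{-1}(\bar 1,\bar t,\overline{t+1}\cdot x)\,\Psi_Y(\bar 1,\bar t,\overline{t+1}\cdot y)\in\mathbb F^\times,$$ let $\Xi_\Gamma\subset\mathbb F^\times$ be the set of $n$-th roots of $\gamma_{x,y}$, and let $\sim$ be the equivalence relation on $\Xi_\Gamma$ given by $\xi_1\sim\xi_2\iff\xi_1^r=\xi_2^r$. Then the isomorphism classes of simple $\mathrm{Vec}_G^\omega$-module functors $\mathcal M(X,\Psi_X)\to\mathcal M(Y,\Psi_Y)$ are in bijection with pairs $(\Gamma,[\xi])$ where $\Gamma\in(X\times Y)/G$ and $[\xi]\in\Xi_\Gamma/\!\sim$. In particular, if the characteristic of $\mathbb F$ is zero, the number of such isomorphism classes is $\sum_{\Gamma\in(X\times Y)/G} n/|\Gamma|$.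
   Context: $\mathbb F$ is an algebraically closed field. For a group $G$ and a normalized 3-cocycle $\omega:G^3\to\mathbb F^\times$ (i.e. $\omega(h,k,l)\omega(g,hk,l)\omega(g,h,k)=\omega(gh,k,l)\omega(g,h,kl)$ and $\omega=1$ if some argument is $1$), $\mathrm{Vec}_G^\omega$ is the monoidal category of finite-dimensional $G$-graded $\mathbb F$-vector spaces with grading-preserving linear maps; its simple objects are $\delta^g$ ($\mathbb F$ in degree $g$), $(V\otimes W)_g=\bigoplus_{hk=g}V_h\otimes W_k$ (so $\delta^g\otimes\delta^h=\delta^{gh}$), and the associator is $a_{\delta^g,\delta^h,\delta^k}=\omega(g,h,k)\,\mathrm{id}_{\delta^{ghk}}$. For a $G$-set $X$ and a map $\Psi:G\times G\times X\to\mathbb F^\times$ that is normalized ($\Psi(g,1,x)=\Psi(1,g,x)=1$) and satisfies $\Psi(h,k,g^{-1}\cdot x)\Psi^{-1}(gh,k,x)\Psi(g,hk,x)\Psi^{-1}(g,h,x)=\omega^{-1}(g,h,k)$ for all $g,h,k\in G,x\in X$, the module category $\mathcal M(X,\Psi)$ is the category of finite-dimensional $X$-graded vector spaces (simple objects identified with the elements $x\in X$) with action $\delta^g\triangleright x=g\cdot x$ (extended bilinearly) and module constraint $m_{\delta^g,\delta^h,x}=\Psi(g,h,(gh)\cdot x)\,\mathrm{id}_{(gh)\cdot x}:(\delta^g\otimes\delta^h)\triangleright x\to\delta^g\triangleright(\delta^h\triangleright x)$. A $\mathrm{Vec}_G^\omega$-module functor $(F,s):\mathcal M\to\mathcal N$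 is an $\mathbb F$-linear functor $F$ with a natural isomorphism $s_{C,M}:F(C\triangleright M)\to C\triangleright F(M)$ satisfying $m'_{C,D,F(M)}\circ s_{C\otimes D,M}=(\mathrm{id}_C\triangleright s_{D,M})\circ s_{C,D\triangleright M}\circ F(m_{C,D,M})$; morphisms are natural transformations $\eta$ with $s^H_{C,M}\circ\eta_{C\triangleright M}=(\mathrm{id}_C\triangleright\eta_M)\circ s^F_{C,M}$. These form an abelian $\mathbb F$-linear category, and a module functor is simple if it is a simple object of this category. *)

(* Defs.v *)
From HB Require Import structures.
From mathcomp Require Import all_boot all_order all_algebra.
Set Implicit Arguments. Unset Strict Implicit. Unset Printing Implicit Defensive.
Import GRing.Theory.
Local Open Scope ring_scope.

Section GroupData.
Variables (G : zmodType) (F : fieldType).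

Definition normalized_3cocycle (w : G -> G -> G -> F) : Prop :=
  (forall g h k, w g h k != 0) /\
  (forall g h k l, w h k l * w g (h + k) l * w g h k = w (g + h) k l * w g h (k + l)) /\
  (forall g h, w 0 g h = 1 /\ w g 0 h = 1 /\ w g h 0 = 1).

Definition is_Gset (X : Type) (act : G -> X -> X) : Prop :=
  (forall x, act 0 x = x) /\ (forall g h x, act (g + h) x = act g (act h x)).

Definition is_modcat_Psi (w : G -> G -> G -> F) (X : Type) (act : G -> X -> X)
    (Psi : G -> G -> X -> F) : Prop :=
  (forall g h x, Psi g h x != 0) /\
  (forall g x, Psi g 0 x = 1 /\ Psi 0 g x = 1) /\
  (forall g h k x,
     Psi h k (act (- g) x) * (Psi (g + h) k x)^-1 * Psi g (h + k) x * (Psi g h x)^-1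
       = (w g h k)^-1).
End GroupData.

(* The module category M(X, Psi): finite-dimensional X-graded vector   *)
(* spaces, modelled as F^d with a homogeneous basis (basis vector i    *)
(* has degree deg i).  Morphisms are degree-preserving matrices acting *)
(* on row vectors (composition f;g is  A *m B).                         *)
Record gobj (X : Type) := GObj { gdim : nat; gdeg : 'I_gdim -> X }.
Arguments GObj {X} gdim gdeg.
Arguments gdim {X} g.
Arguments gdeg {X} g i.

Section ModCat.
Variables (F : fieldType) (G : zmodType).

Definition ghom (X : eqType) (V W : gobj X) (A : 'M[F]_(gdim V, gdim W)) : Prop :=
  forall i j, gdeg V i != gdeg W j -> A i j = 0.

Definition gshift (X : Type) (act : G -> X -> X) (g : G) (V : gobj X) : gobj X :=
  @GObj X (gdim V) (fun i => act g (gdeg V i)).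

(* module constraint m_{delta^g, delta^h, V} :
   (delta^g (x) delta^h) |> V -> delta^g |> (delta^h |> V) *)
Definition mconstr (X : Type) (act : G -> X -> X) (Psi : G -> G -> X -> F)
    (g h : G) (V : gobj X) : 'M[F]_(gdim V) :=
  diag_mx (\row_i Psi g h (act (g + h) (gdeg V i))).

Section ModFun.
Variables (X Y : eqType) (actX : G -> X -> X) (actY : G -> Y -> Y)
          (PsiX : G -> G -> X -> F) (PsiY : G -> G -> Y -> F).

(* data of a module functor (F, s); s is given on the simple objects
   delta^g of Vec_G^omega (it is determined by these by additivity) *)
Record modfun := ModFun {
  fobj : gobj X -> gobj Y;
  fmor : forall V W : gobj X, 'M[F]_(gdim V, gdim W) -> 'M[F]_(gdim (fobj V), gdim (fobj W));
  fstr : forall (g : G) (V : gobj X),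
           'M[F]_(gdim (fobj (gshift actX g V)), gdim (fobj V)) }.

Definition is_modfun (M : modfun) : Prop :=
  (forall V W A, ghom A -> ghom (@fmor M V W A)) /\
  (forall V, @fmor M V V 1%:M = 1%:M) /\
  (forall U V W (A : 'M_(gdim U, gdim V)) (B : 'M_(gdim V, gdim W)),
      ghom A -> ghom B -> fmor M (A *m B) = fmor M A *m fmor M B) /\
  (forall V W (a : F) (A B : 'M_(gdim V, gdim W)),
      ghom A -> ghom B -> fmor M (a *: A + B) = a *: fmor M A + fmor M B) /\
  (forall g V, ghom (V := fobj M (gshift actX g V)) (W := gshift actY g (fobj M V))
                    (fstr M g V)) /\
  (forall g V, exists B : 'M[F]_(gdim (fobj M V), gdim (fobj M (gshift actX g V))),
      ghom (V := gshift actY g (fobj M V)) (W := fobj M (gshift actX g V)) B /\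
      fstr M g V *m B = 1%:M /\ B *m fstr M g V = 1%:M) /\
  (forall g V W (A : 'M_(gdim V, gdim W)), ghom A ->
      @fmor M (gshift actX g V) (gshift actX g W) A *m fstr M g W
        = fstr M g V *m fmor M A) /\
  (forall g h V,
      @fmor M (gshift actX (g + h) V) (gshift actX g (gshift actX h V))
              (mconstr actX PsiX g h V)
        *m fstr M g (gshift actX h V) *m fstr M h V
      = fstr M (g + h) V *m mconstr actY PsiY g h (fobj M V)).

Definition mfmor (M N : modfun) :=
  forall V : gobj X, 'M[F]_(gdim (fobj M V), gdim (fobj N V)).

Definition is_mfmor (M N : modfun) (eta : mfmor M N) : Prop :=
  (forall V, ghom (eta V)) /\
  (forall V W (A : 'M_(gdim V, gdim W)), ghom A ->
      fmor M A *m eta W = eta V *m fmor N A) /\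
  (forall g V, eta (gshift actX g V) *m fstr N g V = fstr M g V *m eta V).

Definition mf_mono (M N : modfun) (eta : mfmor M N) : Prop :=
  forall (K : modfun) (a b : mfmor K M), is_modfun K -> is_mfmor a -> is_mfmor b ->
    (forall V, a V *m eta V = b V *m eta V) -> forall V, a V = b V.

Definition mf_isomorphism (M N : modfun) (eta : mfmor M N) : Prop :=
  exists theta : mfmor N M, is_mfmor theta /\
    (forall V, eta V *m theta V = 1%:M) /\ (forall V, theta V *m eta V = 1%:M).

Definition mf_zero (M : modfun) : Prop := forall V, gdim (fobj M V) = 0%N.

Definition mf_simple (M : modfun) : Prop :=
  is_modfun M /\ ~ mf_zero M /\
  forall (N : modfun) (eta : mfmor N M), is_modfun N -> is_mfmor eta -> mf_mono eta ->
    mf_zero N \/ mf_isomorphism eta.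

Definition mf_iso (M N : modfun) : Prop :=
  exists eta : mfmor M N, is_mfmor eta /\ mf_isomorphism eta.

End ModFun.
End ModCat.

Section Orbits.
Variables (G X Y : finType) (actX : G -> X -> X) (actY : G -> Y -> Y).

Definition diag_orbit (z : X * Y) : {set X * Y} :=
  [set (actX g z.1, actY g z.2) | g : G].

Definition diag_orbits : {set {set X * Y}} := [set diag_orbit z | z : X * Y].
End Orbits.

(* G = Z/nZ is modelled as 'I_n.-1.+1 (for n >= 1 this is Z/nZ), with
   bar k = inZp k. *)
Definition gammaXY (F : fieldType) (n : nat) (X Y : Type)
    (actX : 'I_n.-1.+1 -> X -> X) (actY : 'I_n.-1.+1 -> Y -> Y)
    (PsiX : 'I_n.-1.+1 -> 'I_n.-1.+1 -> X -> F) (PsiY : 'I_n.-1.+1 -> 'I_n.-1.+1 -> Y -> F)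
    (z : X * Y) : F :=
  \prod_(1 <= t < n)
     ((PsiX (inZp 1) (inZp t) (actX (inZp t.+1) z.1))^-1
       * PsiY (inZp 1) (inZp t) (actY (inZp t.+1) z.2)).

(* Main.v *)
(** A module functor F assigns to x in X a Y-graded space, hence to z = (x, y) a space
    V_z, and s_g gives isomorphisms V_{g z} -> V_z.  Since omega cancels, these compose up
    to the 2-cocycle twist = Psi_Y / Psi_X of the action groupoid of Z/n on X x Y.  So F
    decomposes along orbits, and is governed by the operator tau = s_1, whose n-th power
    is gamma_z on V_z.  An eigenvector of tau on an orbit, say with eigenvalue xi, splits
    into vectors v_z of V_z with v_{1.z} tau = xi v_z, that is, it spans a copy of the
    functor that is one-dimensional at each point of the orbit and on which s_1 = xi; here
    xi^n = gamma_z automatically.  A nonzero map between two such functors forces the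
    orbits to agree, and going once around an orbit of size r shows that xi^r is the only
    invariant left.  Simplicity of these functors follows: a nonzero subobject contains
    such a copy, so its monomorphism is split. *)
Require Import Defs.
From HB Require Import structures.
From mathcomp Require Import all_boot all_order all_algebra.
From mathcomp Require Import separable ring.
From Stdlib Require Import ClassicalEpsilon.
Import GRing.Theory.
Local Open Scope ring_scope.
Set Implicit Arguments. Unset Strict Implicit. Unset Printing Implicit Defensive.

(** * Residue classes and the diagonal action on [X * Y] *)

Lemma inZpD (m s t : nat) : inZp (s + t) = inZp s + inZp t :> 'I_m.+1.
Proof. by apply: val_inj; rewrite /= modnDm. Qed.

Lemma inZpn (m : nat) : inZp m.+1 = 0 :> 'I_m.+1.
Proof. by apply: val_inj; rewrite /= modnn. Qed.

Lemma inZp0 (m : nat) : inZp 0 = 0 :> 'I_m.+1.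
Proof. by apply: val_inj; rewrite /= mod0n. Qed.

Section DiagonalAction.
Variables (m : nat) (X Y : finType).
Local Notation G := 'I_m.+1.
Variables (actX : G -> X -> X) (actY : G -> Y -> Y).
Hypotheses (hX : is_Gset actX) (hY : is_Gset actY).

Definition gact (g : G) (z : X * Y) : X * Y := (actX g z.1, actY g z.2).

Lemma gact0 z : gact 0 z = z.
Proof. by case: z => x y; rewrite /gact /= hX.1 hY.1. Qed.

Lemma gactD g h z : gact (g + h) z = gact g (gact h z).
Proof. by rewrite /gact /= hX.2 hY.2. Qed.

Lemma gactK g : cancel (gact g) (gact (- g)).
Proof. by move=> z; rewrite -gactD addNr gact0. Qed.

Lemma gactNK g : cancel (gact (- g)) (gact g).
Proof. by move=> z; rewrite -gactD addrN gact0. Qed.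

Local Notation rot := (gact (inZp 1)).

Lemma iter_rot t z : iter t rot z = gact (inZp t) z.
Proof. by elim: t => [|t IHt] /=; rewrite ?inZp0 ?gact0 // IHt -gactD -inZpD. Qed.

Lemma iter_rot_n z : iter m.+1 rot z = z.
Proof. by rewrite iter_rot inZpn gact0. Qed.

Lemma gact_inj g : injective (gact g).
Proof. exact: can_inj (gactK _). Qed.

(** The class of 1 generates the group, so orbits are the cycles of the single permutation [rot].
    This makes the finite-graph tools [order] and [findex] available. *)
Lemma mem_diag_orbit z z' : (z' \in diag_orbit actX actY z) = fconnect rot z z'.
Proof.
apply/imsetP/idP => [[g _ ->]|/iter_findex <-].
  by rewrite -/(gact g z) -[g]valZpK -iter_rot fconnect_iter.
by exists (inZp (findex rot z z')); rewrite ?iter_rot.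
Qed.

Lemma iter_rot_inj z s t : (s < order rot z)%N -> (t < order rot z)%N ->
  iter s rot z = iter t rot z -> s = t.
Proof. by move=> ls lt e; rewrite -(findex_iter ls) e findex_iter. Qed.

Lemma order_rot_dvd z : (order rot z %| m.+1)%N.
Proof.
have o_gt0 := order_gt0 rot z.
rewrite /dvdn; apply/eqP/(@iter_rot_inj z); rewrite ?ltn_mod //.
have iterM k : iter (k * order rot z) rot z = z.
  by elim: k => //= k IHk; rewrite mulSn iterD IHk iter_order //; apply: (@gact_inj _).
by rewrite -[in RHS](iter_rot_n z) [in RHS](divn_eq m.+1 (order rot z)) addnC iterD iterM.
Qed.

Lemma card_diag_orbit z : #|diag_orbit actX actY z| = order rot z.
Proof. by apply: eq_card => z'; rewrite mem_diag_orbit. Qed.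

Lemma diag_orbit_refl z : z \in diag_orbit actX actY z.
Proof. by rewrite mem_diag_orbit connect0. Qed.

Lemma diag_orbit_eq z z' : z' \in diag_orbit actX actY z ->
  diag_orbit actX actY z' = diag_orbit actX actY z.
Proof.
rewrite mem_diag_orbit => zz'; apply/setP => z''; rewrite !mem_diag_orbit.
by rewrite (same_connect (fconnect_sym (@gact_inj _)) zz').
Qed.

Lemma gact_orbit g z z' :
  (gact g z' \in diag_orbit actX actY z) = (z' \in diag_orbit actX actY z).
Proof.
rewrite !mem_diag_orbit -[g]valZpK -iter_rot.
rewrite !(fconnect_sym (@gact_inj _) z).
by rewrite -(same_connect _ (fconnect_iter rot g z')) //; exact: fconnect_sym (@gact_inj _).
Qed.

(** The values are powers of [c] counted along the cycle from [z]; the hypothesis on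
    [c ^+ order rot z] makes the count close up. With [c] a quotient of two eigenvalues this yields
    the coefficients of an isomorphism. *)
Lemma orbit_geometric (F : fieldType) (c : F) z : c != 0 ->
  c ^+ order rot z = 1 -> exists a : X * Y -> F, (forall z', a z' != 0) /\
    forall z', z' \in diag_orbit actX actY z -> a (rot z') = c * a z'.
Proof.
move=> c_neq0 c_r; exists (fun z' => c ^+ findex rot z z'); split=> [z'|z'].
  exact: expf_neq0.
rewrite mem_diag_orbit => /[dup] zz' /iter_findex {1}<-; rewrite -exprS -iterS.
(* Either [z'] is the last point of the cycle, whose successor is [z] with index 0, or the index
   grows by one. *)
have := findex_max zz'; rewrite leq_eqVlt => /predU1P[e|lt].
  by rewrite e c_r iter_order ?findex0 //; apply: (@gact_inj _).
by rewrite findex_iter.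
Qed.

End DiagonalAction.

(** * The quotient 2-cocycle and the scalars of the model functors *)

Section Cocycle.
Variables (m : nat) (F : fieldType) (X Y : finType).
Local Notation G := 'I_m.+1.
Variables (w : G -> G -> G -> F) (actX : G -> X -> X) (actY : G -> Y -> Y).
Variables (PsiX : G -> G -> X -> F) (PsiY : G -> G -> Y -> F).
Hypotheses (hX : is_Gset actX) (hY : is_Gset actY).
Hypotheses (hPX : is_modcat_Psi w actX PsiX) (hPY : is_modcat_Psi w actY PsiY).
Local Notation gact := (gact actX actY).
Local Notation rot := (gact (inZp 1)).

Definition twist g h (z : X * Y) := PsiY g h z.2 / PsiX g h z.1.

Lemma twist_neq0 g h z : twist g h z != 0.
Proof. by rewrite mulf_neq0 ?invr_eq0 ?hPX.1 ?hPY.1. Qed.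

Lemma twistg0 g z : twist g 0 z = 1.
Proof. by rewrite /twist (hPX.2.1 _ _).1 (hPY.2.1 _ _).1 divr1. Qed.

Lemma twist0g g z : twist 0 g z = 1.
Proof. by rewrite /twist (hPX.2.1 _ _).2 (hPY.2.1 _ _).2 divr1. Qed.

(** [PsiX] and [PsiY] have the same coboundary, the inverse of [w], so it cancels in the
    quotient. *)
Lemma twistM g h k z :
  twist h k (gact (- g) z) * twist g (h + k) z = twist (g + h) k z * twist g h z.
Proof.
have eX := hPX.2.2 g h k z.1; have eY := hPY.2.2 g h k z.2.
move: (etrans eY (esym eX)); rewrite /twist /=.
have := (hPX.1 h k (actX (- g) z.1), hPX.1 g (h + k) z.1, hPX.1 (g + h) k z.1, hPX.1 g h z.1).
have := (hPY.1 h k (actY (- g) z.2), hPY.1 g (h + k) z.2, hPY.1 (g + h) k z.2, hPY.1 g h z.2).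
move=> [[[y1 y2] y3] y4] [[[x1 x2] x3] x4] e.
set a := PsiX h k _ in e x1 *; set b := PsiX g (h + k) _ in e x2 *.
set c := PsiX (g + h) k _ in e x3 *; set d := PsiX g h _ in e x4 *.
set a' := PsiY h k _ in e y1 *; set b' := PsiY g (h + k) _ in e y2 *.
set c' := PsiY (g + h) k _ in e y3 *; set d' := PsiY g h _ in e y4 *.
transitivity ((a' * c'^-1 * b' * d'^-1) * (c' * d') / (a * b)); first by field; rewrite x1 x2 y3 y4.
by rewrite e; field; rewrite x1 x2 x3 x4.
Qed.

Lemma gammaE z : @gammaXY F m.+1 X Y actX actY PsiX PsiY z =
  \prod_(1 <= t < m.+1) twist (inZp 1) (inZp t) (gact (inZp t.+1) z).
Proof. by apply: eq_bigr => t _; rewrite mulrC. Qed.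

(* The scalar by which the structure map of the class of [t] acts in degree [z], given
   that the class of [1] acts everywhere by [xi]. *)
Fixpoint model_str (xi : F) (t : nat) (z : X * Y) : F :=
  if t is t'.+1 then
    xi * model_str xi t' z / twist (inZp 1) (inZp t') (gact (inZp t) z)
  else 1.

Lemma model_str1 xi z : model_str xi 1 z = xi.
Proof. by rewrite /= inZp0 twistg0 mulr1 divr1. Qed.

(** Induction on [s], each step being [twistM] with the class of 1 as first argument. The indices
    are natural numbers because [xi] is arbitrary here: periodicity fails without a condition on
    [xi]. *)
Lemma model_str_add xi s t z : model_str xi s (gact (inZp t) z) * model_str xi t z =
  twist (inZp s) (inZp t) (gact (inZp (s + t)) z) * model_str xi (s + t) z.
Proof.
elim: s => [|s IHs]; first by rewrite inZp0 twist0g !mul1r.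
have := twistM (inZp 1) (inZp s) (inZp t) (gact (inZp (s + t).+1) z).
have -> : gact (- inZp 1) (gact (inZp (s + t).+1) z) = gact (inZp (s + t)) z.
  by rewrite -[(s + t).+1]add1n inZpD (gactD hX hY) (gactK hX hY).
rewrite -!inZpD !add1n => cM.
have -> : model_str xi s.+1 (gact (inZp t) z)
    = xi * model_str xi s (gact (inZp t) z) / twist (inZp 1) (inZp s) (gact (inZp (s + t).+1) z).
  by rewrite /= -(gactD hX hY) -inZpD.
rewrite addSn /=; have n1 := twist_neq0 (inZp 1) (inZp s) (gact (inZp (s + t).+1) z).
have n2 := twist_neq0 (inZp 1) (inZp (s + t)) (gact (inZp (s + t).+1) z).
rewrite [LHS]mulrAC -[X in X / _]mulrA IHs.
apply: (mulIf n1); apply: (mulIf n2); rewrite divfK //.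
transitivity (xi * model_str xi (s + t) z * (twist (inZp s) (inZp t) (gact (inZp (s + t)) z) *
  twist (inZp 1) (inZp (s + t)) (gact (inZp (s + t).+1) z))); first by ring.
by rewrite cM; field.
Qed.

(** The recursion divides by exactly the factors of [gammaXY], the one at index 0 being 1. Hence
    going once through the group gives 1 precisely when [xi] is an [m.+1]-th root of [gammaXY]. *)
Lemma model_str_gamma xi z :
  model_str xi m.+1 z * @gammaXY F m.+1 X Y actX actY PsiX PsiY z = xi ^+ m.+1.
Proof.
rewrite gammaE; have: (0 < m.+1)%N by []; elim: m.+1 => // k IHk _.
case: k => [|k] in IHk *; first by rewrite big_geq // model_str1 mulr1 expr1.
rewrite big_nat_recr //= exprS -IHk //=; set p := \prod_(_ <= _ < _) _.
by field; rewrite !twist_neq0.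
Qed.

Lemma gamma_neq0 z : @gammaXY F m.+1 X Y actX actY PsiX PsiY z != 0.
Proof. by rewrite gammaE prodf_seq_neq0; apply/allP => t _; rewrite twist_neq0. Qed.

(** For [xi = 1], [gammaXY] is the inverse of the scalar of index [m.+1]. Splitting the index [m.+2]
    as [1 + m.+1] and as [m.+1 + 1] shows that this scalar is the same at [z] and [rot z]. *)
Lemma gamma_rot z : @gammaXY F m.+1 X Y actX actY PsiX PsiY (rot z) =
  @gammaXY F m.+1 X Y actX actY PsiX PsiY z.
Proof.
have s1 z' := model_str1 1 z'.
have e : model_str 1 m.+1 (rot z) = model_str 1 m.+1 z.
  have := model_str_add 1 1 m.+1 z; have := model_str_add 1 m.+1 1 z.
  by rewrite !s1 inZpn twist0g twistg0 !mul1r mulr1 addnC => -> ->.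
have := model_str_gamma 1 (rot z); rewrite -(model_str_gamma 1 z) e; apply: mulfI.
by apply: contra_eq_neq (model_str_gamma 1 z) => ->; rewrite mul0r expr1n eq_sym oner_neq0.
Qed.

Lemma gamma_orbit z z' : z' \in diag_orbit actX actY z ->
  @gammaXY F m.+1 X Y actX actY PsiX PsiY z' = @gammaXY F m.+1 X Y actX actY PsiX PsiY z.
Proof.
rewrite (mem_diag_orbit hX hY) => /iter_findex <-.
by elim: (findex _ _ _) => //= k; rewrite gamma_rot.
Qed.

Lemma model_str_neq0 xi t z : xi != 0 -> model_str xi t z != 0.
Proof.
move=> xi0; elim: t => [|t IHt] /=; first exact: oner_neq0.
by rewrite !mulf_neq0 ?invr_eq0 ?twist_neq0.
Qed.

(** The root condition turns the scalar of index [m.+1] into 1, so the scalars depend only on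
    residue classes. *)
Lemma model_str_mod xi t z : xi ^+ m.+1 = @gammaXY F m.+1 X Y actX actY PsiX PsiY z ->
  model_str xi (t %% m.+1) z = model_str xi t z.
Proof.
move=> xi_n; have e : model_str xi m.+1 z = 1.
  by apply: (mulIf (gamma_neq0 z)); rewrite model_str_gamma mul1r.
rewrite [in RHS](divn_eq t m.+1); elim: (_ %/ _)%N => [|k IHk]; first by rewrite mul0n.
have := model_str_add xi (k * m.+1 + t %% m.+1) m.+1 z.
by rewrite inZpn twistg0 gact0 // e mul1r mulr1 -IHk mulSn addnC addnA => ->.
Qed.

Lemma model_strD xi (g h : G) z : xi ^+ m.+1 = @gammaXY F m.+1 X Y actX actY PsiX PsiY z ->
  model_str xi g (gact h z) * model_str xi h z =
  twist g h (gact (g + h) z) * model_str xi (g + h)%R z.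
Proof.
move=> xi_n; have := model_str_add xi g h z.
by rewrite inZpD !valZpK => ->; rewrite [model_str xi (g + h)%R z]model_str_mod.
Qed.

End Cocycle.

(** * Matrices indexed by finite types *)

Section FintypeMatrix.
Variable F : fieldType.
Implicit Types I J K : finType.

Definition fmx I J (f : I -> J -> F) : 'M[F]_(#|I|, #|J|) :=
  \matrix_(i, j) f (enum_val i) (enum_val j).

Lemma eq_fmx I J (f g : I -> J -> F) : f =2 g -> fmx f = fmx g.
Proof. by move=> e; apply/matrixP => i j; rewrite !mxE e. Qed.

Lemma fmxM I J K (f : I -> J -> F) (g : J -> K -> F) :
  fmx f *m fmx g = fmx (fun i k => \sum_j f i j * g j k).
Proof.
apply/matrixP => i k; rewrite !mxE [RHS](reindex _ (onW_bij _ (enum_val_bij J))) /=.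
by apply: eq_bigr => j _; rewrite !mxE.
Qed.

Lemma fmx1 I : fmx (fun i j : I => (i == j)%:R) = 1%:M.
Proof. by apply/matrixP => i j; rewrite !mxE (inj_eq enum_val_inj). Qed.

(** In row-vector convention this sends basis vector [i] to [c i] times basis vector [s i]; all
    structure maps of the model have this shape. *)
Definition monomx I J (s : I -> J) (c : I -> F) := fmx (fun i j => c i *+ (j == s i)).

Lemma mul_monomx I J K (s : I -> J) c (f : J -> K -> F) :
  monomx s c *m fmx f = fmx (fun i k => c i * f (s i) k).
Proof.
rewrite fmxM; apply: eq_fmx => i k; rewrite (bigD1 (s i)) //= eqxx mulr1n.
by rewrite big1 ?addr0 // => j /negPf ->; rewrite mulr0n mul0r.
Qed.

Lemma mul_fmx_monomx I J K (f : I -> J -> F) (s : J -> K) (s' : K -> J) c :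
  cancel s s' -> cancel s' s ->
  fmx f *m monomx s c = fmx (fun i k => f i (s' k) * c (s' k)).
Proof.
move=> sK s'K; rewrite fmxM; apply: eq_fmx => i k.
rewrite (bigD1 (s' k)) //= s'K eqxx mulr1n big1 ?addr0 // => j.
by rewrite -(can2_eq sK s'K) eq_sym => /negPf ->; rewrite mulr0n mulr0.
Qed.

Lemma monomxM I J K (s : I -> J) (t : J -> K) c d :
  monomx s c *m monomx t d = monomx (fun i => t (s i)) (fun i => c i * d (s i)).
Proof. by rewrite mul_monomx; apply: eq_fmx => i k; rewrite mulrnAr. Qed.

Lemma monomx1 I (s : I -> I) c : s =1 id -> c =1 (fun=> 1) -> monomx s c = 1%:M.
Proof. by move=> es ec; rewrite -fmx1; apply: eq_fmx => i j; rewrite es ec eq_sym. Qed.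

Lemma row_fmx_mul I J (f : I -> J -> F) k (A : 'M[F]_(#|J|, k)) i :
  row i (fmx f *m A) = \sum_j f (enum_val i) j *: row (enum_rank j) A.
Proof.
rewrite row_mul mulmx_sum_row [RHS](reindex _ (onW_bij _ (enum_val_bij J))) /=.
by apply: eq_bigr => j _; rewrite !mxE enum_valK.
Qed.

End FintypeMatrix.

(** * The module functor attached to a stable set and a scalar *)

Section Model.
Variables (m : nat) (F : fieldType) (X Y : finType).
Local Notation G := 'I_m.+1.
Variables (w : G -> G -> G -> F) (actX : G -> X -> X) (actY : G -> Y -> Y).
Variables (PsiX : G -> G -> X -> F) (PsiY : G -> G -> Y -> F).
Hypotheses (hX : is_Gset actX) (hY : is_Gset actY).
Hypotheses (hPX : is_modcat_Psi w actX PsiX) (hPY : is_modcat_Psi w actY PsiY).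
Local Notation gact := (gact actX actY).
Local Notation rot := (gact (inZp 1)).
Local Notation model_str := (model_str actX actY PsiX PsiY).

Variable S : {set X * Y}.

(* The model functor sends [V] to the space with one basis vector, of degree [z.2], for
   each [z] in [S] and each basis vector of [V] of degree [z.1]. *)
Definition mbset (V : gobj X) : {set 'I_(gdim V) * (X * Y)} :=
  [set p | (p.2 \in S) && (p.2.1 == gdeg V p.1)].

Definition mbasis (V : gobj X) : finType := {p in mbset V}.

Implicit Types V W : gobj X.

Definition mb1 V (p : mbasis V) : 'I_(gdim V) := (val p).1.
Definition mb2 V (p : mbasis V) : X * Y := (val p).2.

Lemma mbS V (p : mbasis V) : mb2 p \in S.
Proof. by have := valP p; rewrite inE => /andP[]. Qed.

Lemma mbX V (p : mbasis V) : (mb2 p).1 = gdeg V (mb1 p).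
Proof. by have := valP p; rewrite inE => /andP[_ /eqP]. Qed.

Lemma mb_eq V (p q : mbasis V) : (p == q) = (mb1 p == mb1 q) && (mb2 p == mb2 q).
Proof. by []. Qed.

Lemma mb_inj V (p q : mbasis V) : mb1 p = mb1 q -> mb2 p = mb2 q -> p = q.
Proof. by move=> e1 e2; apply/eqP; rewrite mb_eq e1 e2 !eqxx. Qed.

Lemma mb_proof V i z : z \in S -> z.1 = gdeg V i -> (i, z) \in mbset V.
Proof. by move=> zS e; rewrite inE zS e /=. Qed.

Definition mb_mk V i z (zS : z \in S) (e : z.1 = gdeg V i) : mbasis V :=
  exist _ (i, z) (mb_proof zS e).

(** Over a fixed [z] in [S] the basis elements correspond to the [i] of degree [z.1]; this collapses
    sums over intermediate bases. *)
Lemma sum_mbasis (Z : nmodType) V (h : 'I_(gdim V) -> X * Y -> Z) z : z \in S ->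
  \sum_(q : mbasis V) h (mb1 q) (mb2 q) *+ (z == mb2 q) =
  \sum_(i | gdeg V i == z.1) h i z.
Proof.
move=> zS; rewrite -(big_sub (mbset V) (fun q => h q.1 q.2 *+ (z == q.2))) /=.
rewrite (bigID (fun q => z == q.2)) /= [X in _ + X]big1 ?addr0; last first.
  by move=> q /andP[_ /negPf ->].
rewrite (reindex_onto (fun i => (i, z)) fst) /= => [|[i z'] /andP[_ /eqP -> //]].
apply: eq_big => [i|i _]; last by rewrite eqxx.
by rewrite inE /= zS !eqxx !andbT eq_sym.
Qed.

Definition mobj V : gobj Y := @GObj Y #|mbasis V| (fun i => (mb2 (enum_val i)).2).

Definition mmor V W (A : 'M[F]_(gdim V, gdim W)) : 'M[F]_(gdim (mobj V), gdim (mobj W)) :=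
  fmx (fun (p : mbasis V) (q : mbasis W) => A (mb1 p) (mb1 q) *+ (mb2 p == mb2 q)).

Hypothesis S_gact : forall g z, (gact g z \in S) = (z \in S).

Lemma mb_shift_subproof g V (p : mbasis (gshift actX g V)) :
  (gact (- g) (mb2 p)).1 = gdeg V (mb1 p).
Proof. by rewrite /= mbX /= -hX.2 addNr hX.1. Qed.

Definition mb_shift g V (p : mbasis (gshift actX g V)) : mbasis V :=
  mb_mk (etrans (S_gact _ _) (mbS p)) (mb_shift_subproof p).

Lemma mb_unshift_subproof g V (p : mbasis V) :
  (gact g (mb2 p)).1 = gdeg (gshift actX g V) (mb1 p).
Proof. by rewrite /= mbX. Qed.

Definition mb_unshift g V (p : mbasis V) : mbasis (gshift actX g V) :=
  mb_mk (etrans (S_gact _ _) (mbS p)) (mb_unshift_subproof g p).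

Lemma mb_shiftK g V : cancel (@mb_shift g V) (@mb_unshift g V).
Proof. by move=> p; apply: mb_inj; rewrite //= /mb2 /= gactNK. Qed.

Lemma mb_unshiftK g V : cancel (@mb_unshift g V) (@mb_shift g V).
Proof. by move=> p; apply: mb_inj; rewrite //= /mb2 /= gactK. Qed.

Variable xi : F.

Definition mstr g V : 'M[F]_(gdim (mobj (gshift actX g V)), gdim (mobj V)) :=
  monomx (@mb_shift g V) (fun p => model_str xi g (gact (- g) (mb2 p))).

Definition model : modfun F Y actX := ModFun mmor mstr.

Hypothesis xi_n : forall z, z \in S -> xi ^+ m.+1 = @gammaXY F m.+1 X Y actX actY PsiX PsiY z.

Lemma mb_assoc_subproof g h V (p : mbasis (gshift actX (g + h) V)) :
  (mb2 p).1 = gdeg (gshift actX g (gshift actX h V)) (mb1 p).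
Proof. by rewrite mbX /= hX.2. Qed.

Lemma xi_neq0 z : z \in S -> xi != 0.
Proof.
move=> /xi_n e; apply: contra_neq (gamma_neq0 hPX hPY z) => xi0.
by rewrite -e xi0 expr0n.
Qed.

(** Most axioms are bookkeeping on basis elements. Invertibility uses that the scalars are nonzero,
    and the associativity axiom is [model_strD]. *)
Lemma model_modfun : is_modfun actY PsiX PsiY model.
Proof.
split; last split; last split; last split; last split; last split; last split.
- move=> V W A _ i j /= ne; rewrite mxE; case: eqP => // e; case/eqP: ne; by rewrite e.
- move=> V; rewrite /= -fmx1; apply: eq_fmx => p q.
  by rewrite mxE mb_eq; do 2!case: eqP.
- move=> U V W A B hA hB; rewrite /= fmxM; apply: eq_fmx => p q.
  rewrite (eq_bigr (fun r : mbasis V => (A (mb1 p) (mb1 r) * B (mb1 r) (mb1 q)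
      *+ (mb2 r == mb2 q)) *+ (mb2 p == mb2 r))); last first.
    by move=> r _; rewrite mulrnAl mulrnAr.
  rewrite (sum_mbasis (fun i z => A (mb1 p) i * B i (mb1 q) *+ (z == mb2 q))) ?mbS //.
  rewrite sumrMnl; congr (_ *+ _); rewrite mxE [LHS](bigID (fun i => gdeg V i == (mb2 p).1)) /=.
  rewrite [X in _ + X]big1 ?addr0 // => i; rewrite mbX eq_sym => /hA ->; exact: mul0r.
- move=> V W a A B _ _; apply/matrixP => i j; rewrite !mxE mulrnDl; congr (_ + _).
  by rewrite mulrnAr.
- move=> g V i j /=; rewrite mxE => ne; case: eqP => // e; case/eqP: ne.
  by rewrite e /mb2 /= -hY.2 addrN hY.1.
- move=> g V; exists (monomx (@mb_unshift g V) (fun p => (model_str xi g (mb2 p))^-1)).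
  split; [|split].
  + move=> i j /=; rewrite mxE => ne; case: eqP => // e; case/eqP: ne.
    by rewrite e.
  + rewrite /= /mstr monomxM; apply: monomx1 => p; first exact: mb_shiftK.
    by rewrite /mb2 /= divff // (model_str_neq0 hPX hPY) // (xi_neq0 (mbS p)).
  + rewrite /= /mstr monomxM; apply: monomx1 => p; first exact: mb_unshiftK.
    by rewrite {2}/mb2 /= gactK // mulVf // (model_str_neq0 hPX hPY) // (xi_neq0 (mbS p)).
- move=> g V W A _; rewrite /= /mmor (mul_fmx_monomx _ _ (@mb_shiftK g W) (@mb_unshiftK g W)).
  rewrite /mstr mul_monomx; apply: eq_fmx => p q.
  rewrite {2 3 5}/mb2 /= gactK // mulrC (can2_eq (gactNK hX hY g) (gactK hX hY g)).
  by case: eqP => [->|_]; rewrite ?mulr0n ?mulr0 // gactK.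
- move=> g h V.
  (* The shift by [g + h] and the iterated shift have the same basis, but degree functions that
     agree only through [hX.2], so the identification [s] is written out. *)
  pose s p := mb_mk (mbS p) (@mb_assoc_subproof g h V p).
  have -> : fmor model (V := gshift actX (g + h) V) (W := gshift actX g (gshift actX h V))
     (mconstr actX PsiX g h V) = monomx s (fun p => PsiX g h (mb2 p).1).
    apply: eq_fmx => p q; rewrite !mxE mb_eq (mbX p) /= -mulrnA mulnb.
    by rewrite [mb1 q == _]eq_sym [mb2 q == _]eq_sym.
  rewrite /= /mstr !monomxM; apply/matrixP => i j.
  rewrite /mconstr mul_mx_diag !mxE.
  set p := enum_val i; set q := enum_val j.
  have -> : mb_shift (mb_shift (s p)) = mb_shift p.
    by apply: mb_inj => //; rewrite /mb2 /= -gactD // opprD [- h - g]addrC.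
  rewrite [gdeg (mobj V) j]/(mb2 q).2; move: p q => p q {i j}.
  have [->|_] := eqVneq q (mb_shift p); last by rewrite !mulr0n mul0r.
  (* Everything is expressed at the target point [z]: the three points involved are
     [gact (g + h) z], [gact h z] and [z]. *)
  rewrite !mulr1n; pose z := mb2 (mb_shift p).
  have zS : z \in S by exact: mbS.
  have ez : mb2 p = gact (g + h) z by rewrite gactNK.
  have := model_strD hX hY hPX hPY g h (xi_n zS).
  have -> : mb2 (mb_shift (s p)) = gact h z.
    by rewrite -[LHS]/(gact (- g) (mb2 p)) ez gactD // gactK.
  have -> : mb2 (s p) = gact (g + h) z by rewrite -ez.
  have -> : gact (- g) (gact (g + h) z) = gact h z by rewrite gactD // gactK.
  rewrite -/z ez !gactK // => e.
  rewrite -mulrA e /twist /=; have := hPX.1 g h (actX (g + h) z.1).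
  by move=> nz; field.
Qed.

End Model.

(** * Eigenvectors, elementary matrices and graded morphisms *)

(* The factors [A - r] are applied to [u] one at a time until the vector vanishes; the
   last nonzero vector is an eigenvector, still fixed by [E]. *)
Lemma eigenvector_of_pow (F : fieldType) d n (A E : 'M[F]_d) (u : 'rV_d) (c : F) (rs : seq F) :
  'X^n - c%:P = \prod_(r <- rs) ('X - r%:P) ->
  u != 0 -> iter n (mulmxr A) u = c *: u -> u *m E = u -> A *m E = E *m A ->
  exists r (v : 'rV_d), [/\ r ^+ n = c, v != 0, v *m A = r *: v & v *m E = v].
Proof.
case: d A E u => [|d] A E u; first by rewrite (thinmx0 u) eqxx.
move=> rsE u_neq0 uA uE AE.
(* Only the vector [u] is known to be killed by [A ^+ n - c], not the whole space, so the product of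
   the linear factors is applied to [u]. *)
have : u *m \prod_(r <- rs) horner_mx A ('X - r%:P) = 0.
  rewrite -rmorph_prod -rsE rmorphB rmorphXn /= horner_mx_X horner_mx_C mulmxBr mul_mx_scalar.
  suff -> : u *m A ^+ n = iter n (mulmxr A) u by rewrite uA subrr.
  by elim: n {rsE uA} => [|n IHn]; rewrite ?mulmx1 //= exprSr mulmxA IHn.
have rs_root r : r \in rs -> r ^+ n = c.
  move=> r_rs; apply/eqP; rewrite -subr_eq0.
  have := root_prod_XsubC rs r; rewrite r_rs -rsE => /rootP.
  by rewrite !hornerE => ->.
move=> {rsE uA}; elim: rs rs_root u u_neq0 uE => [|r rs IHrs] rs_root u u_neq0 uE.
  by rewrite big_nil mulmx1 => u0; rewrite u0 eqxx in u_neq0.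
rewrite big_cons mulmxA rmorphB /= horner_mx_X horner_mx_C.
have [u0 _|u'_neq0] := eqVneq (u *m (A - r%:M)) 0.
  exists r, u; split; rewrite ?rs_root ?mem_head //.
  by apply/eqP; rewrite -subr_eq0 -mul_mx_scalar -mulmxBr u0.
apply: IHrs => // [s s_rs|]; first by rewrite rs_root // inE s_rs orbT.
by rewrite -mulmxA mulmxBl AE mul_scalar_mx -mul_mx_scalar -mulmxBr mulmxA uE.
Qed.

Lemma mul_deltaE (R : pzRingType) k l n (a : 'I_k) (b : 'I_l) (A : 'M[R]_(l, n)) i j :
  (delta_mx a b *m A) i j = A b j *+ (i == a).
Proof.
rewrite mxE (bigD1 b) //= big1 => [|b' /negPf ne]; last by rewrite mxE ne andbF mul0r.
by rewrite mxE eqxx andbT addr0 mulr_natl.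
Qed.

Lemma mulmx_deltaE (R : pzRingType) k l n (a : 'I_l) (b : 'I_n) (A : 'M[R]_(k, l)) i j :
  (A *m delta_mx a b) i j = A i a *+ (j == b).
Proof.
rewrite mxE (bigD1 a) //= big1 => [|a' /negPf ne]; last by rewrite mxE ne mulr0.
by rewrite mxE eqxx addr0 mulr_natr.
Qed.

Section GradedMorphisms.
Variables (F : fieldType) (X : eqType).
Implicit Types U V W : gobj X.

Lemma ghom0 V W : ghom (V := V) (W := W) (0 : 'M[F]_(_, _)).
Proof. by move=> i j _; rewrite mxE. Qed.

Lemma ghom1 V : ghom (V := V) (W := V) (1%:M : 'M[F]_(_, _)).
Proof. by move=> i j; rewrite mxE; case: (i =P j) => // ->; rewrite eqxx. Qed.

Lemma ghomM U V W (A : 'M[F]_(gdim U, gdim V)) (B : 'M[F]_(gdim V, gdim W)) :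
  ghom A -> ghom B -> ghom (A *m B).
Proof.
move=> hA hB i k ne; rewrite mxE big1 // => j _.
have [e|/hA->] := eqVneq (gdeg U i) (gdeg V j); last exact: mul0r.
by rewrite hB ?mulr0 // -e.
Qed.

Lemma ghomZD V W a (A B : 'M[F]_(gdim V, gdim W)) :
  ghom A -> ghom B -> ghom (a *: A + B).
Proof. by move=> hA hB i j ne; rewrite !mxE hA ?hB ?mulr0 ?addr0. Qed.

Lemma ghom_delta V W i j : gdeg V i = gdeg W j ->
  ghom (V := V) (W := W) (delta_mx i j : 'M[F]_(_, _)).
Proof.
move=> e i' j' ne; rewrite mxE; case: eqP => // ei; case: eqP => // ej.
by case/eqP: ne; rewrite ei ej.
Qed.

End GradedMorphisms.

(** * Module functors and their morphisms *)

Section ModuleFunctors.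
Variables (m : nat) (F : fieldType) (X Y : finType).
Local Notation G := 'I_m.+1.
Variables (w : G -> G -> G -> F) (actX : G -> X -> X) (actY : G -> Y -> Y).
Variables (PsiX : G -> G -> X -> F) (PsiY : G -> G -> Y -> F).
Hypotheses (hX : is_Gset actX) (hY : is_Gset actY).
Hypotheses (hPX : is_modcat_Psi w actX PsiX) (hPY : is_modcat_Psi w actY PsiY).
Local Notation gact := (gact actX actY).
Local Notation rot := (gact (inZp 1)).
Local Notation model_str := (model_str actX actY PsiX PsiY).
Local Notation modfun := (modfun F Y actX).
Local Notation is_modfun := (is_modfun actY PsiX PsiY).
Local Notation mf_mono := (mf_mono actY PsiX PsiY).
Local Notation mf_simple := (mf_simple actY PsiX PsiY).
Local Notation twist := (twist PsiX PsiY).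
Implicit Types (U V W : gobj X) (K L M N : modfun).

Section Category.
Variables (K L M N : modfun).

Definition mfcomp (f : mfmor K L) (g : mfmor L M) : mfmor K M := fun V => f V *m g V.
Definition mfid : mfmor M M := fun V => 1%:M.
Definition mf0 : mfmor M N := fun V => 0.

Lemma mfid_mfmor : is_mfmor mfid.
Proof.
split=> [V|]; first exact: ghom1.
by split=> *; rewrite /mfid ?mulmx1 ?mul1mx.
Qed.

Lemma mf0_mfmor : is_mfmor mf0.
Proof.
split=> [V|]; first exact: ghom0.
by split=> *; rewrite /mf0 ?mulmx0 ?mul0mx.
Qed.

Lemma mfcomp_mfmor (f : mfmor K L) (g : mfmor L M) :
  is_mfmor f -> is_mfmor g -> is_mfmor (mfcomp f g).
Proof.
move=> [f1 [f2 f3]] [g1 [g2 g3]]; split=> [V|]; first exact: ghomM.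
split=> [V W A hA|h V]; first by rewrite /mfcomp mulmxA f2 // -!mulmxA g2.
by rewrite /mfcomp -mulmxA g3 !mulmxA f3.
Qed.

End Category.

Lemma mf_iso_sym (M N : modfun) : mf_iso M N -> mf_iso N M.
Proof.
move=> [f [hf [g [hg [fg gf]]]]]; exists g; split=> //; exists f; by split.
Qed.

Lemma mf_iso_trans (K M N : modfun) : mf_iso K M -> mf_iso M N -> mf_iso K N.
Proof.
move=> [f [hf [g [hg [fg gf]]]]] [f' [hf' [g' [hg' [fg' gf']]]]].
exists (mfcomp f f'); split; first exact: mfcomp_mfmor.
exists (mfcomp g' g); split; first exact: mfcomp_mfmor.
rewrite /mfcomp; split=> V; first by rewrite mulmxA -(mulmxA (f V)) fg' mulmx1 fg.
by rewrite mulmxA -(mulmxA (g' V)) gf mulmx1 gf'.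
Qed.

(* A module functor and its morphisms are determined by what they do on this direct
   sum of all simple objects. *)
Definition Tobj : gobj X := @GObj X #|X| (fun i => enum_val i).

(** Translation by [g] permutes the points of [X], so [Tobj] is isomorphic to its own shift. This
    turns the structure maps into endomorphisms of one space. *)
Definition shiftT_mx (g : G) : 'M[F]_(gdim Tobj, gdim (gshift actX g Tobj)) :=
  \matrix_(i, j) (enum_val i == actX g (enum_val j))%:R.

Definition inT V i : 'M[F]_(gdim V, gdim Tobj) := delta_mx i (enum_rank (gdeg V i)).

Definition outT V (x : X) i : 'M[F]_(gdim Tobj, gdim V) := delta_mx (enum_rank x) i.

Arguments inT : clear implicits.
Arguments outT : clear implicits.

Lemma ghom_inT V i : ghom (inT V i).
Proof. by apply: ghom_delta; rewrite /= enum_rankK. Qed.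

Lemma ghom_outT V x i : x = gdeg V i -> ghom (outT V x i).
Proof. by move=> e; apply: ghom_delta; rewrite /= enum_rankK. Qed.

Lemma ghom_tperm g : ghom (V := Tobj) (W := gshift actX g Tobj) (shiftT_mx g).
Proof. by move=> i j /negPf ne; rewrite mxE /= ne. Qed.

Lemma inoutT V i j : inT V i *m outT V (gdeg V i) j = delta_mx i j.
Proof. by rewrite mul_delta_mx. Qed.

Lemma actXK g : cancel (actX g) (actX (- g)).
Proof. by move=> x; rewrite -hX.2 addNr hX.1. Qed.

Lemma actYK g : cancel (actY g) (actY (- g)).
Proof. by move=> y; rewrite -hY.2 addNr hY.1. Qed.

Lemma actYNK g : cancel (actY (- g)) (actY g).
Proof. by move=> y; rewrite -hY.2 addrN hY.1. Qed.

Lemma shiftT_mxM g h : shiftT_mx g *m shiftT_mx h = shiftT_mx (g + h) :> 'M_#|X|.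
Proof.
apply/matrixP => i j; rewrite mxE (bigD1 (enum_rank (actX h (enum_val j)))) //= big1 => [|k ne].
  by rewrite !mxE enum_rankK eqxx mulr1 addr0 hX.2.
rewrite !mxE; case: (enum_val k =P _) => [e|]; rewrite ?mulr0 //.
by case/eqP: ne; rewrite -e enum_valK.
Qed.

(** * The graded pieces of one module functor and its operators [tau] *)

Section OneFunctor.
Variables (M : modfun) (hM : is_modfun M).

Lemma fmor_ghom V W A : ghom A -> ghom (@fmor _ _ _ _ _ M V W A).
Proof. exact: hM.1. Qed.

Lemma fmor1 V : @fmor _ _ _ _ _ M V V 1%:M = 1%:M.
Proof. exact: hM.2.1. Qed.

Lemma fmorM U V W (A : 'M_(gdim U, gdim V)) (B : 'M_(gdim V, gdim W)) :
  ghom A -> ghom B -> fmor M (A *m B) = fmor M A *m fmor M B.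
Proof. exact: hM.2.2.1. Qed.

Lemma fmorZD V W a (A B : 'M_(gdim V, gdim W)) :
  ghom A -> ghom B -> fmor M (a *: A + B) = a *: fmor M A + fmor M B.
Proof. exact: hM.2.2.2.1. Qed.

Lemma fstr_ghom g V :
  ghom (V := fobj M (gshift actX g V)) (W := gshift actY g (fobj M V)) (fstr M g V).
Proof. exact: hM.2.2.2.2.1. Qed.

Lemma fstr_inv g V : exists B, fstr M g V *m B = 1%:M /\ B *m fstr M g V = 1%:M.
Proof. by have [B [_ ?]] := hM.2.2.2.2.2.1 g V; exists B. Qed.

Lemma fstr_nat g V W (A : 'M_(gdim V, gdim W)) : ghom A ->
  @fmor _ _ _ _ _ M (gshift actX g V) (gshift actX g W) A *m fstr M g W
    = fstr M g V *m fmor M A.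
Proof. exact: hM.2.2.2.2.2.2.1. Qed.

Lemma fstr_assoc g h V :
  @fmor _ _ _ _ _ M (gshift actX (g + h) V) (gshift actX g (gshift actX h V))
              (mconstr actX PsiX g h V)
        *m fstr M g (gshift actX h V) *m fstr M h V
      = fstr M (g + h) V *m mconstr actY PsiY g h (fobj M V).
Proof. exact: hM.2.2.2.2.2.2.2. Qed.

Lemma fmor0 V W : fmor M (0 : 'M_(gdim V, gdim W)) = 0.
Proof.
have := fmorZD 1 (@ghom0 F X V W) (@ghom0 F X V W).
by rewrite scaler0 addr0 scale1r => /esym/eqP; rewrite -subr_eq0 addrK => /eqP.
Qed.

Lemma fmorZ V W a (A : 'M_(gdim V, gdim W)) : ghom A -> fmor M (a *: A) = a *: fmor M A.
Proof. by move=> hA; rewrite -[a *: A]addr0 fmorZD ?fmor0 ?addr0 //; apply: ghom0. Qed.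

Lemma fmorD V W (A B : 'M_(gdim V, gdim W)) :
  ghom A -> ghom B -> fmor M (A + B) = fmor M A + fmor M B.
Proof. by move=> hA hB; rewrite -[A in LHS]scale1r fmorZD // scale1r. Qed.

Lemma fmor_sum V W (I : finType) (P : pred I) (A : I -> 'M_(gdim V, gdim W)) :
  (forall i, P i -> ghom (A i)) ->
  fmor M (\sum_(i | P i) A i) = \sum_(i | P i) fmor M (A i).
Proof.
(* [fmor] is assumed additive only on homogeneous matrices, so homogeneity of the partial sums is
   carried through the induction. *)
move=> hA; suff [] : fmor M (\sum_(i | P i) A i) = \sum_(i | P i) fmor M (A i)
  /\ ghom (\sum_(i | P i) A i) by [].
apply: (big_ind2 (fun B C => fmor M B = C /\ ghom B)) => [|B B' C C' [<- hB] [<- hC]|i Pi].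
- by split; [exact: fmor0 | exact: ghom0].
- by rewrite fmorD //; split=> //; rewrite -[B]scale1r; apply: ghomZD.
- by split=> //; apply: hA.
Qed.

Lemma mx1_inoutT V : 1%:M = \sum_i inT V i *m outT V (gdeg V i) i.
Proof.
rewrite -[LHS]trmx1 trmx1 mx1_sum_delta; by apply: eq_bigr => i _; rewrite inoutT.
Qed.

(** The identity of [V] is a sum of graded maps factoring through [Tobj], and naturality moves [f V]
    past them to become [f Tobj]. *)
Lemma mfmor_ext (N : modfun) (f h : mfmor M N) : is_mfmor f -> is_mfmor h ->
  f Tobj = h Tobj -> forall V, f V = h V.
Proof.
move=> [_ [f2 _]] [_ [h2 _]] e V.
have hin i : ghom (inT V i *m outT V (gdeg V i) i).
  by apply: ghomM; [exact: ghom_inT | exact: ghom_outT].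
rewrite -[f V]mul1mx -[h V]mul1mx -fmor1 mx1_inoutT fmor_sum //.
rewrite !mulmx_suml; apply: eq_bigr => i _.
rewrite fmorM; [|exact: ghom_inT|exact: ghom_outT].
by rewrite -!mulmxA f2 ?h2 ?e //; apply: ghom_outT.
Qed.

(** Identity and zero transformation then agree at [Tobj], hence everywhere, and an identity matrix
    that vanishes has size 0. *)
Lemma mf_zeroT : gdim (fobj M Tobj) = 0%N -> mf_zero M.
Proof.
move=> d0 V; have eT : mfid M Tobj = mf0 M M Tobj.
  by apply/matrixP => i; have := leq_trans (ltn_ord i) (eq_leq d0).
have := mfmor_ext (mfid_mfmor M) (mf0_mfmor M M) eT V; rewrite /mfid /mf0.
case: (gdim _) => // d /matrixP/(_ ord0 ord0)/eqP.
by rewrite !mxE eqxx oner_eq0.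
Qed.

(* [tau g] is the structure map s_g of the direct sum of all [V_z], and [pr z] below is
   the projection onto [V_z]. *)
Definition tau g : 'M[F]_(gdim (fobj M Tobj)) := fmor M (shiftT_mx g) *m fstr M g Tobj.

Definition prX (x : X) : 'M[F]_(gdim (fobj M Tobj)) :=
  fmor M (outT Tobj x (enum_rank x)).

Definition prY (y : Y) : 'M[F]_(gdim (fobj M Tobj)) :=
  diag_mx (\row_j (gdeg (fobj M Tobj) j == y)%:R).

Definition pr (z : X * Y) := prX z.1 *m prY z.2.

Lemma ghom_EX x : ghom (V := Tobj) (W := Tobj) (outT Tobj x (enum_rank x)).
Proof. by apply: ghom_outT; rewrite /= enum_rankK. Qed.

Lemma tau_ghom g :
  ghom (V := fobj M Tobj) (W := gshift actY g (fobj M Tobj)) (tau g).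
Proof.
apply: (ghomM (U := fobj M Tobj) (V := fobj M (gshift actX g Tobj))
  (W := gshift actY g (fobj M Tobj))); last exact: fstr_ghom.
by apply: fmor_ghom; apply: ghom_tperm.
Qed.

Lemma prX_ghom x : ghom (V := fobj M Tobj) (W := fobj M Tobj) (prX x).
Proof. exact/fmor_ghom/ghom_EX. Qed.

Lemma mul_prY_l (A : 'M[F]_(gdim (fobj M Tobj))) g y :
  ghom (V := fobj M Tobj) (W := gshift actY g (fobj M Tobj)) A ->
  prY (actY g y) *m A = A *m prY y.
Proof.
move=> hA; apply/matrixP => i j; rewrite mul_diag_mx mul_mx_diag !mxE.
have [e|/hA->] := eqVneq (gdeg (fobj M Tobj) i) (gdeg (gshift actY g (fobj M Tobj)) j);
  last by rewrite mul0r mulr0.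
rewrite mulrC e /=; congr (_ * _%:R); by rewrite (can_eq (actYK g)).
Qed.

Lemma prX_prY x y : prX x *m prY y = prY y *m prX x.
Proof.
rewrite -[in RHS](hY.1 y) mul_prY_l // => i j; rewrite /= hY.1; exact: prX_ghom.
Qed.

Lemma prX_tau g x : prX (actX g x) *m tau g = tau g *m prX x.
Proof.
rewrite /tau mulmxA -fmorM; [|exact: ghom_EX|exact: ghom_tperm].
rewrite -mulmxA -fstr_nat ?mulmxA; last exact: ghom_EX.
rewrite -fmorM; [|exact: ghom_tperm|].
  congr (fmor M _ *m _); apply/matrixP => i j.
  rewrite mul_deltaE mulmx_deltaE !mxE !enum_rankK.
  rewrite -!(can2_eq (@enum_valK X) (@enum_rankK X)).
  by rewrite (inj_eq (can_inj (actXK g))) -!mulrnA !mulnb eq_sym andbC.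
by apply: ghom_delta; rewrite /= enum_rankK.
Qed.

(** In row-vector convention: [tau g] maps the piece at [gact g z] into the piece at [z]. *)
Lemma pr_tau g z : pr (gact g z) *m tau g = tau g *m pr z.
Proof.
rewrite /pr /= -mulmxA (mul_prY_l z.2 (@tau_ghom g)). 
by rewrite (mulmxA (prX _) (tau g)) prX_tau -mulmxA.
Qed.

Lemma prX_id x : prX x *m prX x = prX x.
Proof. by rewrite /prX -fmorM ?mul_delta_mx //; apply: ghom_EX. Qed.

Lemma prX_orth x x' : x != x' -> prX x *m prX x' = 0.
Proof.
move=> ne; rewrite /prX -fmorM; [|exact: ghom_EX|exact: ghom_EX].
by rewrite mul_delta_mx_0 ?fmor0 // (inj_eq enum_rank_inj).
Qed.

Lemma prY_id y : prY y *m prY y = prY y.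
Proof.
apply/matrixP => i j; rewrite mul_diag_mx !mxE.
by case: eqP; rewrite ?mul1r ?mul0r ?mul0rn.
Qed.

Lemma prY_orth y y' : y != y' -> prY y *m prY y' = 0.
Proof.
move=> /negPf ne; apply/matrixP => i j; rewrite mul_diag_mx !mxE.
by case: eqP => [->|_]; rewrite ?mul0r // ne mul0rn mulr0.
Qed.

Lemma pr_id z : pr z *m pr z = pr z.
Proof.
by rewrite /pr -mulmxA (mulmxA (prY _)) -prX_prY -(mulmxA (prX _)) prY_id mulmxA prX_id.
Qed.

Lemma pr_orth z z' : z != z' -> pr z *m pr z' = 0.
Proof.
rewrite /pr -mulmxA (mulmxA (prY _)) -prX_prY -(mulmxA (prX z'.1)) mulmxA => ne.
have [e1|/prX_orth->] := eqVneq z.1 z'.1; last by rewrite mul0mx.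
have [e2|/prY_orth->] := eqVneq z.2 z'.2; last by rewrite mulmx0.
by case/eqP: ne; rewrite [z]surjective_pairing e1 e2 -surjective_pairing.
Qed.

Lemma sum_pr : \sum_z pr z = 1%:M.
Proof.
rewrite /pr -(pair_bigA _ (fun x y => prX x *m prY y)) /=.
have sumY : \sum_y prY y = 1%:M.
  apply/matrixP => i j; rewrite summxE (bigD1 (gdeg (fobj M Tobj) i)) //=.
  rewrite big1 => [|y /negPf ne]; rewrite !mxE ?eqxx ?addr0 //.
  by rewrite eq_sym ne mul0rn.
under eq_bigr do rewrite -mulmx_sumr sumY mulmx1.
rewrite -fmor1 mx1_inoutT fmor_sum => [|i _]; last first.
  by apply: ghomM; [exact: ghom_inT | exact: ghom_outT].
rewrite (reindex _ (onW_bij _ (enum_val_bij X))) /=.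
by apply: eq_bigr => i _; rewrite /inT /outT mul_delta_mx /prX /outT enum_valK.
Qed.

(** The associativity axiom, restricted to the piece at [z]: there both module constraints act by
    scalars. *)
Lemma tauM g h z k (u : 'M_(k, gdim (fobj M Tobj))) : u *m pr z = u ->
  PsiX g h z.1 *: (u *m tau g *m tau h) = PsiY g h z.2 *: (u *m tau (g + h)).
Proof.
case: z => x y /= uz.
have uX : u *m prX x = u.
  by rewrite -{1}uz /pr -!mulmxA -prX_prY (mulmxA (prX x)) prX_id.
have uY : u *m prY y = u by rewrite -{1}uz /pr -!mulmxA prY_id.
set x' := outT Tobj x (enum_rank x).
have hx' : ghom x' by exact: ghom_EX.
pose Pgh : 'M_(gdim Tobj, gdim (gshift actX g (gshift actX h Tobj))) := shiftT_mx g *m shiftT_mx h.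
have hPh : ghom (V := gshift actX g Tobj) (W := gshift actX g (gshift actX h Tobj)) (shiftT_mx h).
  move=> i j /=; rewrite mxE (inj_eq (can_inj (actXK g))); by move/negPf->.
have ePgh : Pgh = shiftT_mx (g + h) := shiftT_mxM g h.
have hPgh : ghom Pgh.
  exact: (@ghomM _ _ _ (gshift actX g Tobj)) (@ghom_tperm g) hPh.
pose mc : 'M[F]_(gdim (gshift actX (g + h) Tobj), gdim (gshift actX g (gshift actX h Tobj))) :=
  mconstr actX PsiX g h Tobj.
have hmc : ghom (V := gshift actX (g + h) Tobj) (W := gshift actX g (gshift actX h Tobj)) mc.
  move=> i j /=; rewrite /mc /mconstr -hX.2 !mxE => ne.
  by case: (i =P j) => // e; case/eqP: ne; rewrite e.
(* Preceded by the projection onto [x], the constraint of [X] is the scalar [PsiX g h x]. *)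
have eP : PsiX g h x *: (x' *m Pgh) = x' *m (shiftT_mx (g + h) *m mc).
  apply/matrixP => i j; rewrite mxE !mul_deltaE mul_mx_diag ePgh !mxE.
  rewrite enum_rankK mulrnAr; congr (_ *+ _).
  by case: eqP => [->|_]; rewrite ?mul0r ?mulr0 // mulr1 mul1r.
have e1 : tau g *m tau h =
    fmor M Pgh *m (fstr M g (gshift actX h Tobj) *m fstr M h Tobj).
  rewrite /Pgh fmorM //; last exact: ghom_tperm.
  rewrite /tau -!mulmxA; congr (_ *m _); rewrite !mulmxA; congr (_ *m _).
  by rewrite -(@fstr_nat g _ _ _ (@ghom_tperm h)).
have eF : PsiX g h x *: (prX x *m fmor M Pgh) = prX x *m (fmor M (shiftT_mx (g + h)) *m fmor M mc).
  rewrite -[prX x]/(fmor M x') -!fmorM -?fmorZ ?eP //; try exact: ghom_tperm.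
  - exact: ghomM hx' hPgh.
  - exact: (@ghomM _ _ _ (gshift actX (g + h) Tobj)) (@ghom_tperm _) hmc.
have e2 : PsiX g h x *: (u *m tau g *m tau h) =
    u *m tau (g + h) *m mconstr actY PsiY g h (fobj M Tobj).
  rewrite -(mulmxA u (tau g)) e1 -{1}uX -(mulmxA u) (mulmxA (prX x)) scalemxAr scalemxAl eF.
  rewrite /tau -!mulmxA (mulmxA u (prX x)) uX; congr (_ *m (_ *m _)).
  by rewrite -fstr_assoc mulmxA.
(* The result sits in degree [actY (- (g + h)) y], and the constraint of [Y] evaluates [PsiY] at the
   translate of that degree by [g + h], which is [y]. *)
have hy : u *m tau (g + h) = u *m tau (g + h) *m prY (actY (- (g + h)) y).
  by rewrite -mulmxA -(mul_prY_l _ (@tau_ghom _)) -hY.2 addrN hY.1 mulmxA uY.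
rewrite e2 hy -[LHS]mulmxA scalemxAr; congr (_ *m _).
apply/matrixP => i j; rewrite mul_mx_diag !mxE mulrC.
case: (i =P j) => [->|_]; last by rewrite !mulr0n !mulr0.
by case: (gdeg _ j =P _) => [->|_]; rewrite ?mul0rn ?mulr0 // actYNK.
Qed.

(* [tau 0] is an invertible idempotent. *)
Lemma tau0 : tau 0 = 1%:M.
Proof.
have [B [sB _]] := fstr_inv 0 Tobj.
have t00 : tau 0 *m tau 0 = tau 0.
  rewrite -[LHS]mul1mx -[RHS]mul1mx -sum_pr !mulmx_suml; apply: eq_bigr => z _.
  have := tauM 0 0 (pr_id z); rewrite (hPX.2.1 _ _).1 (hPY.2.1 _ _).1 !scale1r addr0.
  by rewrite mulmxA.
have P0 : shiftT_mx 0 = 1%:M by apply/matrixP => i j; rewrite !mxE hX.1 (inj_eq enum_val_inj).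
pose I := (1%:M : 'M[F]_(gdim (gshift actX 0 Tobj), gdim Tobj)).
have hI : ghom I by move=> i j; rewrite mxE /= hX.1 (inj_eq enum_val_inj) => /negPf ->.
have tC : tau 0 *m (B *m fmor M I) = 1%:M.
  rewrite /tau -mulmxA (mulmxA _ B) sB mul1mx -fmorM //; last exact: ghom_tperm.
  by rewrite P0 mul1mx /I fmor1.
by rewrite -[tau 0]mulmx1 -tC mulmxA t00.
Qed.

Lemma pr_tau_row g z k (u : 'M_(k, gdim (fobj M Tobj))) :
  u *m pr (gact g z) = u -> u *m tau g *m pr z = u *m tau g.
Proof. by move=> uz; rewrite -(mulmxA u (tau g)) -pr_tau mulmxA uz. Qed.

Lemma tauM_twist g h z k (u : 'M_(k, gdim (fobj M Tobj))) : u *m pr z = u ->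
  u *m tau g *m tau h = twist g h z *: (u *m tau (g + h)).
Proof.
move/(tauM g h) => e; apply: (scalerI (hPX.1 g h z.1)).
by rewrite e scalerA /twist mulrCA divff ?mulr1 // hPX.1.
Qed.

Local Notation tau1 := (mulmxr (tau (inZp 1))).

Lemma iter_tau t z k (u : 'M_(k, gdim (fobj M Tobj))) :
  u *m pr (gact (inZp t) z) = u -> iter t tau1 u =
  (\prod_(1 <= s < t) twist (inZp 1) (inZp s) (gact (inZp s.+1) z)) *: (u *m tau (inZp t)).
Proof.
elim: t u => [|t IHt] u; first by rewrite inZp0 tau0 mulmx1 big_geq // scale1r.
move=> ut; rewrite iterSr.
have ut1 : u *m pr (gact (inZp 1) (gact (inZp t) z)) = u by rewrite -gactD // -inZpD.
rewrite (IHt _ (pr_tau_row ut1)) (tauM_twist _ _ ut) -inZpD scalerA.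
(* The product starts at index 1, so for [t = 0] the new factor [twist (inZp 1) 0] has to be 1,
   which is normalization. *)
case: t {IHt ut1} ut => [|t] ut; last by rewrite [in RHS]big_nat_recr.
by rewrite !big_geq // inZp0 (twistg0 hPX hPY) mul1r.
Qed.

Lemma iter_tau_n z k (u : 'M_(k, gdim (fobj M Tobj))) : u *m pr z = u ->
  iter m.+1 tau1 u = @gammaXY F m.+1 X Y actX actY PsiX PsiY z *: u.
Proof.
move=> uz; have := @iter_tau m.+1 z k u; rewrite inZpn gact0 // => /(_ uz) ->.
by rewrite tau0 mulmx1 gammaE.
Qed.

(** * Eigenfamilies and the morphisms they induce *)

Definition eigenfamily (S : {set X * Y}) (xi : F) (v : X * Y -> 'rV_(gdim (fobj M Tobj))) :=
  forall z, z \in S -> v z *m pr z = v z /\ v (rot z) *m tau (inZp 1) = xi *: v z.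

Section Eigenfamily.
Variables (S : {set X * Y}) (xi : F) (v : X * Y -> 'rV[F]_(gdim (fobj M Tobj))).
Hypothesis S_gact : forall g z, (gact g z \in S) = (z \in S).
Hypothesis hv : eigenfamily S xi v.

Lemma eigenfamily_tau (g : G) z : z \in S -> v (gact g z) *m tau g = model_str xi g z *: v z.
Proof.
move=> zS; rewrite -[in LHS](valZpK g); elim: (val g) => [|t IHt].
  by rewrite inZp0 gact0 // tau0 mulmx1 scale1r.
have tS : gact (inZp t) z \in S by rewrite S_gact.
have t1S : gact (inZp t.+1) z \in S by rewrite S_gact.
have et : gact (inZp t.+1) z = rot (gact (inZp t) z) by rewrite -gactD // -inZpD.
have := tauM_twist (inZp 1) (inZp t) (hv t1S).1.
rewrite {1}et (hv tS).2 -scalemxAl IHt scalerA -inZpD /= => e.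
apply: (scalerI (twist_neq0 hPX hPY (inZp 1) (inZp t) (gact (inZp t.+1) z))).
by rewrite -e scalerA /=; congr (_ *: _); field; rewrite (twist_neq0 hPX hPY).
Qed.

Local Notation model := (model PsiX PsiY hX S_gact xi).

(** Naturality forces this formula: the basis element at [(i, z)] is the image of the one over [z]
    at [Tobj] under the map sending component [z.1] to [i]. *)
Definition model_map : mfmor model M := fun V => \matrix_(i < #|mbasis S V|)
  (v (mb2 (enum_val i)) *m fmor M (outT V (mb2 (enum_val i)).1 (mb1 (enum_val i)))).

Lemma model_map_mfmor : is_mfmor model_map.
Proof.
split; last split.
- move=> V i j; rewrite /model_map mxE; set p := enum_val i => ne.
  have vY : v (mb2 p) *m prY (mb2 p).2 = v (mb2 p).
    by rewrite -{1}(hv (mbS p)).1 /pr -!mulmxA prY_id; exact: (hv (mbS p)).1.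
  have hF : ghom (fmor M (outT V (mb2 p).1 (mb1 p))) by apply/fmor_ghom/ghom_outT/mbX.
  rewrite mxE big1 // => k _.
  have [e|/hF->] := eqVneq (gdeg (fobj M Tobj) k) (gdeg (fobj M V) j); last exact: mulr0.
  by rewrite -vY mul_mx_diag !mxE e eq_sym (negPf ne) mulr0 mul0r.
(* Linearity of [fmor] reduces naturality to a matrix identity: by homogeneity, row [mb1 p] of [A]
   only involves basis vectors of [W] of degree [(mb2 p).1]. *)
- move=> V W A hA; apply/row_matrixP => i; rewrite /= row_fmx_mul row_mul !rowK.
  set p := enum_val i.
  under eq_bigr => q _ do rewrite rowK enum_rankK -scalerMnl.
  rewrite (sum_mbasis (fun i z => A (mb1 p) i *: (v z *m fmor M (outT W z.1 i)))) ?mbS //.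
  under eq_bigr do rewrite scalemxAr.
  rewrite -mulmx_sumr -mulmxA -fmorM //; last exact/ghom_outT/mbX.
  congr (_ *m _).
  have hO j : gdeg W j == (mb2 p).1 -> ghom (outT W (mb2 p).1 j).
    by move=> /eqP e; apply: ghom_outT.
  under eq_bigr => j Wj do rewrite -(fmorZ _ (hO j Wj)).
  rewrite -fmor_sum => [|j Wj]; last first.
    by rewrite -[_ *: _]addr0; apply: ghomZD (hO j Wj) _; apply: ghom0.
  congr (fmor M _); apply/matrixP => a b; rewrite summxE mul_deltaE.
  under eq_bigr do rewrite !mxE.
  case: (a =P _) => [_|_] /=; last by rewrite big1 // => j _; rewrite mulr0.
  rewrite mulr1n.
  under eq_bigr do rewrite eq_sym mulr_natr.
  have [e|ne] := eqVneq (gdeg W b) (mb2 p).1.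
    rewrite (bigD1 b) ?e //=.
    rewrite eqxx big1 ?addr0 // => j /andP[_ /negPf ne].
    by rewrite ne.
  rewrite big1 => [|j /eqP e]; first by rewrite hA // -mbX eq_sym.
  by case: eqP => // ej; case/eqP: ne; rewrite -ej e.
- move=> g V; apply/row_matrixP => i; rewrite /= /mstr row_mul rowK row_fmx_mul.
  set p := enum_val i; rewrite (bigD1 (mb_shift hX S_gact p)) //= eqxx mulr1n rowK enum_rankK.
  rewrite big1 ?addr0; last by move=> q /negPf ->; rewrite mulr0n scale0r.
  have zS := mbS (mb_shift hX S_gact p).
  have ez : mb2 p = gact g (mb2 (mb_shift hX S_gact p)) by rewrite gactNK.
  rewrite {1 2}ez [gact (- g) (mb2 p)]/(mb2 (mb_shift hX S_gact p)).
  set z := mb2 _ in zS *; rewrite scalemxAl -eigenfamily_tau // -!mulmxA; congr (_ *m _).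
  (* The map from [Tobj] to the shifted [V] factors through the shift of [Tobj]; its first factor is
     the one occurring in [tau g]. *)
  have eO : outT (gshift actX g V) (gact g z).1 (mb1 p) = shiftT_mx g *m outT V z.1 (mb1 p).
    apply/matrixP => a b; rewrite mulmx_deltaE !mxE enum_rankK /= mulrb.
    rewrite -(can2_eq (@enum_valK X) (@enum_rankK X)).
    by case: eqP => // _; case: eqP.
  have hO : ghom (outT V z.1 (mb1 p)) by exact/ghom_outT/mbX.
  have hO' : ghom (V := gshift actX g Tobj) (W := gshift actX g V) (outT V z.1 (mb1 p)).
    by apply: ghom_delta; rewrite /= enum_rankK -hX.2 addrN hX.1 mbX.
  by rewrite eO (fmorM (@ghom_tperm g) hO') -!mulmxA fstr_nat // mulmxA.
Qed.

Lemma pr_prX z : pr z *m prX z.1 = pr z.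
Proof. by rewrite /pr -mulmxA -prX_prY mulmxA prX_id. Qed.

Lemma row_model_mapT i : row i (model_map Tobj) = v (mb2 (enum_val i)).
Proof.
rewrite rowK; set p := enum_val i.
have -> : mb1 p = enum_rank (mb2 p).1 by rewrite mbX /= enum_valK.
by rewrite -[fmor M _]/(prX _) -{1}(hv (mbS p)).1 -mulmxA pr_prX (hv (mbS p)).1.
Qed.

Hypothesis v_neq0 : forall z, z \in S -> v z != 0.

(** The rows are separated by mapping back to [Tobj] and projecting: [fmor M (inT V i)] singles out
    the basis index and [pr z] the point, leaving the nonzero vector [v z]. *)
Lemma model_map_inj V k (A : 'M_(k, gdim (fobj model V))) : A *m model_map V = 0 -> A = 0.
Proof.
move=> A0; apply/matrixP => r i; rewrite [RHS]mxE; set p := enum_val i; pose z := mb2 p.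
have vz : v z *m pr z = v z := (hv (mbS p)).1.
have key j : row j (model_map V) *m fmor M (inT V (mb1 p)) *m pr z = v z *+ (j == i).
  rewrite rowK; set q := enum_val j; rewrite -(mulmxA (v _)) -fmorM; first last.
  - exact: ghom_inT.
  - exact/ghom_outT/mbX.
  have [e1|ne1] := eqVneq (mb1 q) (mb1 p); last first.
    rewrite mul_delta_mx_0 // fmor0 mulmx0 mul0mx.
    by case: (j =P i) => // e; case/eqP: ne1; rewrite /q e.
  rewrite /outT /inT e1 mul_delta_mx -e1 -(mbX q) -[fmor M _]/(prX _).
  have [vq _] := hv (mbS q); rewrite -vq -(mulmxA (v _)) pr_prX -mulmxA.
  have [e2|ne2] := eqVneq (mb2 q) (mb2 p).
    have -> : j == i by apply/eqP/enum_val_inj/mb_inj.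
    by rewrite e2 pr_id vz.
  rewrite (pr_orth ne2) mulmx0; case: (j =P i) => // e; case/eqP: ne2; by rewrite /q e.
have /rowP/(_ _) : row r A *m model_map V *m fmor M (inT V (mb1 p)) *m pr z = 0.
  by rewrite -row_mul A0 row0 !mul0mx.
rewrite [row r A *m _]mulmx_sum_row !mulmx_suml (bigD1 i) //=.
rewrite big1 ?addr0 => [|j /negPf ne]; last first.
  by rewrite -!scalemxAl key ne mulr0n scaler0.
rewrite -!scalemxAl key eqxx mulr1n => e; apply/eqP.
have /eqP : row r A 0 i *: v z = 0 by apply/rowP.
by rewrite scaler_eq0 (negPf (v_neq0 (mbS p))) orbF mxE.
Qed.

Lemma model_map_mono : mf_mono model_map.
Proof.
move=> K a b _ _ _ e V; apply/eqP; rewrite -subr_eq0; apply/eqP.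
by apply: (@model_map_inj V); rewrite mulmxBl e subrr.
Qed.
End Eigenfamily.

(** Some piece is nonzero, and on it the [m.+1]-th power of [tau] is a scalar; the resulting
    eigenvector is cut into its components along the orbit. *)
Lemma eigenfamily_exists : gdim (fobj M Tobj) != 0%N ->
  (forall c : F, exists rs, 'X^(m.+1) - c%:P = \prod_(r <- rs) ('X - r%:P)) ->
  exists z xi v, [/\ xi ^+ m.+1 = @gammaXY F m.+1 X Y actX actY PsiX PsiY z,
    eigenfamily (diag_orbit actX actY z) xi v &
    forall z', z' \in diag_orbit actX actY z -> v z' != 0].
Proof.
move=> d_neq0 splitF.
have [z pz] : exists z, pr z != 0.
  apply/existsP; apply: contraNT d_neq0; rewrite negb_exists => /forallP p0.
  have : 1%:M = 0 :> 'M[F]_(gdim (fobj M Tobj)).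
    by rewrite -sum_pr big1 // => z _; apply/eqP; have := p0 z; rewrite negbK.
  by case: (gdim _) => // d /matrixP/(_ ord0 ord0)/eqP; rewrite !mxE eqxx oner_eq0.
have /rowV0Pn [u /submxP [D uD] u_neq0] := pz.
have uz : u *m pr z = u by rewrite uD -mulmxA pr_id.
set S := diag_orbit actX actY z; have zS : z \in S := diag_orbit_refl hX hY z.
have S_gact g z' : (gact g z' \in S) = (z' \in S) := gact_orbit hX hY g z z'.
(* [E] projects onto the pieces over the orbit; it commutes with [tau] and keeps the eigenvector
   supported there. *)
pose E := \sum_(z' in S) pr z'.
have pE z' : z' \in S -> pr z' *m E = pr z'.
  move=> z'S; rewrite mulmx_sumr (bigD1 z') //= pr_id big1 ?addr0 // => z'' /andP[_ ne].
  by rewrite pr_orth // eq_sym.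
have uE : u *m E = u by rewrite -uz -mulmxA pE.
have tE : tau (inZp 1) *m E = E *m tau (inZp 1).
  rewrite mulmx_sumr mulmx_suml [RHS](reindex rot) /=; last first.
    by apply: onW_bij; exists (gact (- inZp 1)); [exact: gactK | exact: gactNK].
  by apply: eq_big => [z'|z' _]; rewrite ?S_gact // pr_tau.
have [rs rsE] := splitF (@gammaXY F m.+1 X Y actX actY PsiX PsiY z).
have [xi [v [xi_n v_neq0 vt vE]]] := eigenvector_of_pow rsE u_neq0 (iter_tau_n uz) uE tE.
exists z, xi, (fun z' => v *m pr z'); split=> //.
  move=> z' z'S; split; first by rewrite -mulmxA pr_id.
  by rewrite -mulmxA pr_tau mulmxA vt scalemxAl.
have xi_neq0 : xi != 0.
  by apply: contra_neq (gamma_neq0 hPX hPY z) => xi0; rewrite -xi_n xi0 expr0n.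
(* [tau] maps the component at [rot z'] to [xi] times the one at [z'], so nonvanishing propagates
   forwards along the orbit. *)
have step z' : v *m pr z' != 0 -> v *m pr (rot z') != 0.
  apply: contra_neq => e; apply: (scalerI xi_neq0); rewrite scaler0.
  by rewrite scalemxAl -vt -mulmxA -pr_tau mulmxA e mul0mx.
have [z1 z1S vz1] : exists2 z1, z1 \in S & v *m pr z1 != 0.
  apply/exists_inP; apply: contraNT v_neq0; rewrite negb_exists_in => /forall_inP p0.
  rewrite -vE mulmx_sumr big1 // => z' /p0; by rewrite negbK => /eqP.
move=> z'; rewrite -(diag_orbit_eq hX hY z1S) (mem_diag_orbit hX hY) => /iter_findex <-.
by elim: (findex _ _ _) => [|k IHk] //=; apply: step.
Qed.
End OneFunctor.

(** * Morphisms between the model functors *)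

Lemma diagonal_mulV d (A B : 'M[F]_d) (c : 'I_d -> F) : (forall i, c i != 0) ->
  (forall i, row i A = c i *: delta_mx 0 i) ->
  (forall i, row i B = (c i)^-1 *: delta_mx 0 i) -> A *m B = 1%:M /\ B *m A = 1%:M.
Proof.
move=> c_neq0 rA rB; split; apply/row_matrixP => i; rewrite row_mul row1.
  by rewrite rA -scalemxAl -rowE rB scalerA divff // scale1r.
by rewrite rB -scalemxAl -rowE rA scalerA mulVf // scale1r.
Qed.

Lemma mfmor_pr (M N : modfun) (f : mfmor M N) z : is_mfmor f ->
  pr M z *m f Tobj = f Tobj *m pr N z.
Proof.
move=> [f1 [f2 _]]; rewrite /pr mulmxA -f2; last exact: ghom_EX.
rewrite -!mulmxA; congr (_ *m _); apply/matrixP => i j.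
rewrite mul_diag_mx mul_mx_diag !mxE mulrC.
by have [->//|/f1->] := eqVneq (gdeg (fobj M Tobj) i) (gdeg (fobj N Tobj) j); rewrite !mul0r.
Qed.

Lemma mfmor_tau (M N : modfun) (f : mfmor M N) g : is_mfmor f ->
  tau M g *m f Tobj = f Tobj *m tau N g.
Proof.
move=> [_ [f2 f3]]; rewrite /tau -mulmxA -f3 !mulmxA; congr (_ *m _).
exact: f2 (@ghom_tperm g).
Qed.

Section ModelAtT.
Variables (S : {set X * Y}) (xi : F).
Hypothesis S_gact : forall g z, (gact g z \in S) = (z \in S).
Hypothesis xi_n : forall z, z \in S -> xi ^+ m.+1 = @gammaXY F m.+1 X Y actX actY PsiX PsiY z.
Local Notation model := (model PsiX PsiY hX S_gact xi).

(** At [Tobj] the model has exactly one basis vector over each point of [S]; off [S] this vector is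
    zero. *)
Definition bvec z : 'rV[F]_(#|mbasis S Tobj|) := \row_j (mb2 (enum_val j) == z)%:R.

Lemma mbXT (p : mbasis S Tobj) : enum_val (mb1 p) = (mb2 p).1.
Proof. exact: esym (mbX p). Qed.

Lemma mb2T_inj : injective (@mb2 X Y S Tobj).
Proof.
move=> p q e; apply: mb_inj => //; apply: enum_val_inj.
by rewrite !mbXT e.
Qed.

Lemma mb2T_eq i j :
  (mb2 (enum_val i) == mb2 (enum_val j) :> X * Y) = (i == j :> 'I_#|mbasis S Tobj|).
Proof. by rewrite (inj_eq mb2T_inj) (inj_eq enum_val_inj). Qed.

Lemma mb2T_ex z : z \in S -> exists i : 'I_#|mbasis S Tobj|, mb2 (enum_val i) = z.
Proof.
move=> zS; have e : z.1 = gdeg Tobj (enum_rank z.1) by rewrite /= enum_rankK.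
by exists (enum_rank (mb_mk zS e)); rewrite enum_rankK.
Qed.

Lemma bvec_delta i : bvec (mb2 (enum_val i)) = delta_mx 0 i.
Proof. by apply/rowP => j; rewrite !mxE mb2T_eq. Qed.

Lemma bvec_neq0 z : z \in S -> bvec z != 0.
Proof.
case/mb2T_ex => i <-; rewrite bvec_delta; apply/eqP => /rowP/(_ i)/eqP.
by rewrite !mxE !eqxx oner_eq0.
Qed.

Lemma bvec0 z : z \notin S -> bvec z = 0.
Proof.
by move=> zS; apply/rowP => j; rewrite !mxE; case: eqP zS => // <-; rewrite mbS.
Qed.

Lemma model_prE z i j : pr model z i j = ((i == j) && (mb2 (enum_val j) == z))%:R.
Proof.
rewrite /pr mul_mx_diag !mxE /= mb2T_eq.
have [->|ne] := eqVneq i j; last by rewrite mulr0n mul0r.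
set q := enum_val j; rewrite !andbb mulr1n -natrM mulnb /=; congr (_%:R).
rewrite -(can2_eq (@enum_valK X) (@enum_rankK X)) mbXT.
by rewrite -pair_eqE.
Qed.

Lemma model_tauE g i j : tau model g i j =
  (mb2 (enum_val i) == gact g (mb2 (enum_val j)))%:R * model_str xi g (mb2 (enum_val j)).
Proof.
rewrite /tau /= /mmor /mstr (mul_fmx_monomx _ _ (@mb_shiftK _ _ _ _ _ hX hY S S_gact g Tobj)
  (@mb_unshiftK _ _ _ _ _ hX hY S S_gact g Tobj)) !mxE.
set p := enum_val i; set q := enum_val j.
rewrite {2 3}/mb2 /= -/(mb2 q) gactK //.
case: (mb2 p =P _) => [e|_]; last by rewrite mulr0n !mul0r.
rewrite mulr1n -[mb1 (mb_unshift _ _ _)]/(mb1 q) !mbXT e eqxx //.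
Qed.

Lemma bvec_eigenfamily : @eigenfamily model S xi bvec.
Proof.
move=> z zS; split.
  have [i <-] := mb2T_ex zS; rewrite bvec_delta -rowE; apply/rowP => j.
  rewrite mxE model_prE mxE eqxx /= mb2T_eq eq_sym; by rewrite [j == i]eq_sym andbb.
have zS1 : rot z \in S by rewrite S_gact.
have [i ei] := mb2T_ex zS1; rewrite -ei bvec_delta -rowE; apply/rowP => j.
rewrite mxE model_tauE ei !mxE (inj_eq (@gact_inj _ _ _ _ _ hX hY _)) eq_sym mulrC.
case: eqP => [->|_]; rewrite ?mulr0 // !mulr1 /=.
(* The representative of the class of 1 is [1 %% m.+1], which is 0 for the trivial group; there the
   root condition is what makes the scalar equal to [xi]. *)
by rewrite (model_str_mod hX hY hPX hPY 1 (xi_n zS)) (model_str1 hPX hPY).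
Qed.

(** The image of [pr model z] is at most a line. Summing all coordinates reads off the coefficient
    without naming its index, and also covers [z] outside [S]. *)
Lemma pr_bvec u z : u *m pr model z = u -> u = (\sum_j u 0 j) *: bvec z.
Proof.
move=> uz.
have u0 j : mb2 (enum_val j) != z -> u 0 j = 0.
  move=> /negPf ne; rewrite -uz mxE big1 // => k _.
  by rewrite model_prE ne andbF mulr0.
apply/rowP => j; rewrite !mxE; have [e|/u0->] := eqVneq (mb2 (enum_val j)) z; last by rewrite mulr0.
rewrite mulr1 (bigD1 j) //= big1 ?addr0 // => k ne; apply: u0.
by rewrite -e mb2T_eq.
Qed.

End ModelAtT.

Section ModelMorphism.
Variables (S S' : {set X * Y}) (xi xi' : F).
Hypotheses (S_gact : forall g z, (gact g z \in S) = (z \in S)).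
Hypotheses (S_gact' : forall g z, (gact g z \in S') = (z \in S')).
Hypothesis xi_n : forall z, z \in S -> xi ^+ m.+1 = @gammaXY F m.+1 X Y actX actY PsiX PsiY z.
Hypothesis xi_n' : forall z, z \in S' -> xi' ^+ m.+1 = @gammaXY F m.+1 X Y actX actY PsiX PsiY z.
Local Notation mod1 := (model PsiX PsiY hX S_gact xi).
Local Notation mod2 := (model PsiX PsiY hX S_gact' xi').

(** A morphism commutes with the [pr z], so it preserves the lines over the points; commuting with
    [tau] gives the recurrence for its coefficients. *)
Lemma model_mfmor_coef (f : mfmor mod2 mod1) : is_mfmor f ->
  exists a : X * Y -> F, (forall z, z \in S' -> bvec S' z *m f Tobj = a z *: bvec S z) /\
    (forall z, z \in S' -> z \in S -> a (rot z) * xi = xi' * a z).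
Proof.
move=> hf; pose v z := bvec S' z *m f Tobj.
have [a vE] : exists a : X * Y -> F, forall z, z \in S' -> v z = a z *: bvec S z.
  exists (fun z => \sum_j v z 0 j) => z zS'.
  apply: (pr_bvec (S_gact := S_gact) (xi := xi)).
  by rewrite /v -mulmxA -(mfmor_pr _ hf) mulmxA (bvec_eigenfamily S_gact' xi_n' zS').1.
exists a; split=> // z zS' zS.
have : v (rot z) *m tau mod1 (inZp 1) = xi' *: v z.
  rewrite /v -mulmxA -(mfmor_tau _ hf) mulmxA (bvec_eigenfamily S_gact' xi_n' zS').2.
  by rewrite scalemxAl.
rewrite !vE ?S_gact' // -scalemxAl (bvec_eigenfamily S_gact xi_n zS).2 !scalerA.
move/eqP; rewrite -subr_eq0 -scalerBl scaler_eq0 (negPf (bvec_neq0 zS)) orbF subr_eq0.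
by move/eqP.
Qed.

End ModelMorphism.

Lemma scaled_bvec_eigenfamily (S : {set X * Y}) (xi xi' : F) (a : X * Y -> F)
    (S_gact : forall g z, (gact g z \in S) = (z \in S)) :
  (forall z, z \in S -> xi ^+ m.+1 = @gammaXY F m.+1 X Y actX actY PsiX PsiY z) ->
  (forall z, z \in S -> a (rot z) * xi = xi' * a z) ->
  @eigenfamily (model PsiX PsiY hX S_gact xi) S xi' (fun z => a z *: bvec S z).
Proof.
move=> xi_n a_rot z zS; have [b1 b2] := bvec_eigenfamily S_gact xi_n zS.
by rewrite -!scalemxAl b1 b2 !scalerA a_rot.
Qed.

Section DiagonalMorphism.
Variables (S : {set X * Y}) (xi xi' : F).
Hypotheses (S_gact S_gact' : forall g z, (gact g z \in S) = (z \in S)).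
Hypothesis xi_n : forall z, z \in S -> xi ^+ m.+1 = @gammaXY F m.+1 X Y actX actY PsiX PsiY z.
Hypothesis xi_n' : forall z, z \in S -> xi' ^+ m.+1 = @gammaXY F m.+1 X Y actX actY PsiX PsiY z.
Local Notation mod1 := (model PsiX PsiY hX S_gact xi).
Local Notation mod2 := (model PsiX PsiY hX S_gact' xi').
Variable a : X * Y -> F.
Hypothesis a_neq0 : forall z, z \in S -> a z != 0.
Hypothesis a_rot : forall z, z \in S -> a (rot z) * xi = xi' * a z.
Variable f : mfmor mod2 mod1.
Hypothesis hf : is_mfmor f.
Hypothesis f_diag : forall z, z \in S -> bvec S z *m f Tobj = a z *: bvec S z.

(** The inverse comes from the eigenfamily with the inverse coefficients; by [mfmor_ext] it is
    enough to check both composites at [Tobj]. *)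
Lemma diag_mfmor_iso : mf_isomorphism f.
Proof.
have hM1 := model_modfun hX hY hPX hPY S_gact xi_n.
have hM2 := model_modfun hX hY hPX hPY S_gact' xi_n'.
have av_rot z : z \in S -> (a (rot z))^-1 * xi' = xi * (a z)^-1.
  move=> zS; have zS1 : rot z \in S by rewrite S_gact.
  apply: (mulfI (a_neq0 zS1)); apply: (mulIf (a_neq0 zS)).
  by rewrite mulVKf ?a_neq0 // mulrA divfK ?a_neq0 // a_rot.
have hv := scaled_bvec_eigenfamily S_gact' xi_n' av_rot.
have htheta := model_map_mfmor hM2 S_gact hv.
set theta := model_map _ _ _ in htheta.
pose c (i : 'I_#|mbasis S Tobj|) := a (mb2 (enum_val i)).
have c_neq0 i : c i != 0 by exact/a_neq0/mbS.
have fT i : row i (f Tobj : 'M_#|mbasis S Tobj|) = c i *: delta_mx 0 i.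
  by rewrite rowE -bvec_delta; apply/f_diag/mbS.
have tT i : row i (theta Tobj : 'M_#|mbasis S Tobj|) = (c i)^-1 *: delta_mx 0 i.
  by rewrite -bvec_delta; exact: (row_model_mapT hM2 hv).
have [ft tf] := diagonal_mulV c_neq0 fT tT.
exists theta; split=> //; split.
  exact: (mfmor_ext hM2 (mfcomp_mfmor hf htheta) (mfid_mfmor _) ft).
exact: (mfmor_ext hM1 (mfcomp_mfmor htheta hf) (mfid_mfmor _) tf).
Qed.
End DiagonalMorphism.

(** The stability proof is built in, so the term depends on [z] and not only on its orbit;
    [omodel_rebase] repairs this. *)
Definition omodel z xi : modfun := model PsiX PsiY hX (fun g z' => gact_orbit hX hY g z z') xi.

Local Notation gamma := (@gammaXY F m.+1 X Y actX actY PsiX PsiY).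
Local Notation orb := (diag_orbit actX actY).

Lemma orbit_xi_n z xi : xi ^+ m.+1 = gamma z -> forall z', z' \in orb z -> xi ^+ m.+1 = gamma z'.
Proof. by move=> xi_n z' z'z; rewrite xi_n (gamma_orbit hX hY hPX hPY z'z). Qed.

Lemma omodel_modfun z xi : xi ^+ m.+1 = gamma z -> is_modfun (omodel z xi).
Proof.
move=> /orbit_xi_n; exact: (model_modfun hX hY hPX hPY (fun g z' => gact_orbit hX hY g z z')).
Qed.

(** A form of Schur's lemma. One nonzero coefficient makes the two orbits meet; the recurrence then
    spreads it over the orbit, and closing the cycle compares the powers of [xi] and [xi']. *)
Lemma omodel_hom z z' xi xi' (f : mfmor (omodel z' xi') (omodel z xi)) :
  xi ^+ m.+1 = gamma z -> xi' ^+ m.+1 = gamma z' -> is_mfmor f -> f Tobj != 0 ->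
  [/\ orb z' = orb z, xi' ^+ #|orb z| = xi ^+ #|orb z| & mf_isomorphism f].
Proof.
move=> /orbit_xi_n xi_n /orbit_xi_n xi_n' hf f_neq0.
have [a [fa a_rot]] := model_mfmor_coef xi_n xi_n' hf.
have [i fi] : exists i, row i (f Tobj) != 0.
  apply/existsP; apply: contraNT f_neq0; rewrite negb_exists => /forallP f0.
  by apply/eqP/row_matrixP => i; rewrite row0; apply/eqP; have := f0 i; rewrite negbK.
pose z1 := mb2 (enum_val i); have z1S' : z1 \in orb z' := mbS _.
move: fi; rewrite rowE -bvec_delta fa // scaler_eq0 negb_or => /andP[az1 bz1].
have z1S : z1 \in orb z by apply: contraNT bz1 => /bvec0 ->.
have eS : orb z' = orb z by rewrite -(diag_orbit_eq hX hY z1S) (diag_orbit_eq hX hY z1S').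
have ak k : a (iter k rot z1) * xi ^+ k = xi' ^+ k * a z1.
  elim: k => [|k IHk]; first by rewrite mulrC.
  have h1 : iter k rot z1 \in orb z' by rewrite iter_rot // gact_orbit.
  have h2 : iter k rot z1 \in orb z by rewrite iter_rot // gact_orbit.
  by rewrite exprS mulrA iterS (a_rot _ h1 h2) -mulrA IHk exprS mulrA.
have xi'_neq0 := xi_neq0 hPX hPY xi_n' z1S'.
have a_neq0 z2 : z2 \in orb z -> a z2 != 0.
  rewrite -(diag_orbit_eq hX hY z1S) (mem_diag_orbit hX hY) => /iter_findex <-.
  move: (findex _ _ _) => k; apply: contra_neq (mulf_neq0 (expf_neq0 k xi'_neq0) az1) => a0.
  by rewrite -ak a0 mul0r.
split=> //.
  rewrite -(diag_orbit_eq hX hY z1S) card_diag_orbit //; apply: (mulIf az1).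
  by rewrite -ak iter_order 1?mulrC //; apply: gact_inj.
(* The orbit of [z'] and its stability proof are generalized, so that the two orbits can be
   identified by [subst]. *)
move: eS f hf fa a_rot xi_n' {i z1 z1S' z1S az1 bz1 ak f_neq0}; rewrite /omodel.
move: (fun g z2 => gact_orbit hX hY g z' z2) => S_gact'; move: (orb z') S_gact' => S' S_gact' eS.
subst S' => f hf fa a_rot xi_n'.
by apply: (@diag_mfmor_iso _ _ _ _ _ xi_n xi_n' a) => // z2 z2S; apply: a_rot.
Qed.

(** Coefficients in geometric progression of ratio [xi' / xi] close up around the orbit by the
    hypothesis on the powers. *)
Lemma omodel_iso z xi xi' : xi ^+ m.+1 = gamma z -> xi' ^+ m.+1 = gamma z ->
  xi' ^+ #|orb z| = xi ^+ #|orb z| -> mf_iso (omodel z xi') (omodel z xi).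
Proof.
move=> e e' er; have xi_n := orbit_xi_n e; have xi_n' := orbit_xi_n e'.
have zz := diag_orbit_refl hX hY z.
have xi0 := xi_neq0 hPX hPY xi_n zz; have xi'0 := xi_neq0 hPX hPY xi_n' zz.
have [||a [a_neq0 a_rot]] := @orbit_geometric _ _ _ _ _ hX hY _ (xi' / xi) z.
- by rewrite mulf_neq0 ?invr_eq0.
- by rewrite -(card_diag_orbit hX hY) expr_div_n er divff // expf_neq0.
have a_rot' z' : z' \in orb z -> a (rot z') * xi = xi' * a z'.
  by move=> /a_rot ->; rewrite mulrAC divfK.
have hM := omodel_modfun e.
have hv := scaled_bvec_eigenfamily (fun g z' => gact_orbit hX hY g z z') xi_n a_rot'.
have hf := model_map_mfmor hM (fun g z' => gact_orbit hX hY g z z') hv.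
eexists; split; first exact: hf.
apply: (diag_mfmor_iso xi_n xi_n' _ a_rot' hf) => // z' z'S.
have [i <-] := mb2T_ex z'S; rewrite [in LHS]bvec_delta -rowE.
exact: (row_model_mapT hM hv).
Qed.

Lemma omodel_rebase z z' xi : orb z' = orb z -> mf_iso (omodel z xi) (omodel z' xi).
Proof.
rewrite /omodel; move: (fun g z2 => gact_orbit hX hY g z z2) => S_gact.
move: (fun g z2 => gact_orbit hX hY g z' z2) => S_gact'.
move: (orb z) (orb z') S_gact S_gact' => S S' S_gact S_gact' eS; subst S'.
pose I V : 'M[F]_#|mbasis S V| := 1%:M.
have IC V W (B C : 'M[F]_(#|mbasis S V|, #|mbasis S W|)) : B = C -> I V *m B = C *m I W.
  by move=> ->; rewrite /I mul1mx mulmx1.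
(* Basis elements are compared through their values, so the matrices do not depend on the stability
   proof. *)
have strE (Sg Sg' : forall g z, (gact g z \in S) = (z \in S)) g V :
    mstr PsiX PsiY hX Sg' xi g V = mstr PsiX PsiY hX Sg xi g V.
  by apply: eq_fmx => p q; rewrite !mb_eq.
have hid (Sg Sg' : forall g z, (gact g z \in S) = (z \in S)) :
    @is_mfmor _ _ _ _ _ (model PsiX PsiY hX Sg xi) (model PsiX PsiY hX Sg' xi) I.
  split=> [V|]; first exact: (@ghom1 F _ (mobj S V)).
  split=> [V W A _|g V]; first exact: esym (IC _ _ _ _ (erefl (mmor S A))).
  exact: (IC _ _ _ _ (strE Sg Sg' g V)).
exists I; split; first exact: hid.
exists I; split; first exact: hid.
split=> V; exact: (mulmx1 (I V)).
Qed.

Lemma omodel_iso_inv z z' xi xi' : xi ^+ m.+1 = gamma z -> xi' ^+ m.+1 = gamma z' ->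
  mf_iso (omodel z' xi') (omodel z xi) ->
  orb z' = orb z /\ xi' ^+ #|orb z| = xi ^+ #|orb z|.
Proof.
move=> xi_n xi_n' [f [hf [theta [_ [ft _]]]]].
suff f_neq0 : f Tobj != 0 by have [] := omodel_hom xi_n xi_n' hf f_neq0.
apply/eqP => f0; have := ft Tobj; rewrite f0 mul0mx => /matrixP e.
have [i _] := mb2T_ex (diag_orbit_refl hX hY z').
by have /eqP := e i i; rewrite !mxE eqxx eq_sym oner_eq0.
Qed.

Lemma eigenfamily_map (M : modfun) : is_modfun M -> ~ mf_zero M ->
  (forall c : F, exists rs, 'X^(m.+1) - c%:P = \prod_(r <- rs) ('X - r%:P)) ->
  exists z xi (f : mfmor (omodel z xi) M),
    [/\ xi ^+ m.+1 = gamma z, is_mfmor f, mf_mono f & f Tobj != 0].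
Proof.
move=> hM M_neq0 splitF.
have [|z [xi [v [xi_n hv v_neq0]]]] := eigenfamily_exists hM _ splitF.
  by apply/eqP => /(mf_zeroT hM).
exists z, xi, (model_map xi v (fun g z' => gact_orbit hX hY g z z')); split=> //.
- exact: model_map_mfmor.
- exact: model_map_mono.
have zz := diag_orbit_refl hX hY z; have [i ei] := mb2T_ex zz.
apply: contra_neq (v_neq0 z zz) => f0.
by rewrite -ei -(row_model_mapT hM (S_gact := fun g z' => gact_orbit hX hY g z z') hv) f0 row0.
Qed.

(** * Simplicity of the models and exhaustion of the simple functors *)

Section Simple.
Hypothesis splitF : forall c : F, exists rs, 'X^(m.+1) - c%:P = \prod_(r <- rs) ('X - r%:P).

(** A nonzero subobject [N] receives a nonzero map [j] from some [omodel]; following it by the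
    monomorphism [eta] gives a nonzero map between two models, hence an isomorphism, and [eta] is
    split. *)
Lemma omodel_simple z xi : xi ^+ m.+1 = gamma z -> mf_simple (omodel z xi).
Proof.
move=> xi_n; have hM := omodel_modfun xi_n; split=> //; split.
  move=> /(_ Tobj) /= card0.
  have [i _] := mb2T_ex (diag_orbit_refl hX hY z).
  by have := leq_trans (ltn_ord i) (eq_leq card0).
move=> N eta hN heta eta_mono.
have [d0|d_neq0] := eqVneq (gdim (fobj N Tobj)) 0%N; first by left; apply: mf_zeroT.
have N_neq0 : ~ mf_zero N by move=> /(_ Tobj)/eqP; apply/negP.
right; have [z' [xi' [j [xi_n' hj _ j_neq0]]]] := eigenfamily_map hN N_neq0 splitF.
have hf := mfcomp_mfmor hj heta.
have f_neq0 : mfcomp j eta Tobj != 0.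
  apply: contra_neq j_neq0 => f0.
  have K := omodel_modfun xi_n'.
  apply: (eta_mono (omodel z' xi') j (mf0 _ _) K hj (mf0_mfmor _ _)) => V.
  rewrite mul0mx; exact: (mfmor_ext K hf (mf0_mfmor _ _) f0).
have [_ _ [theta [htheta [ft tf]]]] := omodel_hom xi_n xi_n' hf f_neq0.
exists (mfcomp theta j); split; first exact: mfcomp_mfmor.
have tje V : mfcomp theta j V *m eta V = 1%:M by rewrite /mfcomp -mulmxA tf.
(* The other composite is identified with the identity by cancelling [eta]. *)
split=> V; last exact: tje.
have hid := mfid_mfmor N.
apply: (eta_mono N (mfcomp eta (mfcomp theta j)) (mfid N) hN _ hid _ V) => [|V'].
  by apply: mfcomp_mfmor heta _; apply: mfcomp_mfmor.
by rewrite /mfcomp -!mulmxA tf mulmx1 mul1mx.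
Qed.

Lemma simple_omodel (M : modfun) : mf_simple M -> exists z xi,
  xi ^+ m.+1 = gamma z /\ mf_iso (omodel z xi) M.
Proof.
move=> [hM [M_neq0 M_simple]].
have [z [xi [f [xi_n hf f_mono f_neq0]]]] := eigenfamily_map hM M_neq0 splitF.
exists z, xi; split=> //; exists f; split=> //.
have [zero|//] := M_simple _ f (omodel_modfun xi_n) hf f_mono.
by have [_ [_]] := omodel_simple xi_n; have [] := (omodel_simple xi_n).2.1.
Qed.

End Simple.

End ModuleFunctors.

(** * Roots of [X^n - c] *)

Section Roots.
Variable F : closedFieldType.
Implicit Types (c : F) (n : nat).

Definition Xn_roots n c : seq F := sval (closed_field_poly_normal ('X^n - c%:P)).

Lemma Xn_rootsE n c : (0 < n)%N -> 'X^n - c%:P = \prod_(r <- Xn_roots n c) ('X - r%:P).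
Proof.
move=> n_gt0; rewrite /Xn_roots; case: closed_field_poly_normal => rs /=.
by rewrite lead_coefXnsubC // scale1r.
Qed.

Lemma size_Xn_roots n c : (0 < n)%N -> size (Xn_roots n c) = n.
Proof.
move=> n_gt0; apply: succn_inj.
by rewrite -(size_XnsubC c n_gt0) Xn_rootsE // size_prod_XsubC.
Qed.

Lemma mem_Xn_roots n c r : (0 < n)%N -> (r \in Xn_roots n c) = (r ^+ n == c).
Proof.
move=> n_gt0; rewrite -root_prod_XsubC -Xn_rootsE //.
by rewrite /root !hornerE subr_eq0.
Qed.

Lemma uniq_Xn_roots n c : n%:R != 0 :> F -> c != 0 -> uniq (Xn_roots n c).
Proof.
move=> n_neq0 c_neq0.
have n_gt0 : (0 < n)%N by rewrite lt0n; apply: contra_neq n_neq0 => ->.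
rewrite -separable_prod_XsubC -Xn_rootsE // unlock; apply/Bezout_coprimepP.
(* Bezout coefficients for the polynomial and its derivative: [- (X^n - c) + (X / n) * n X^(n-1)] is
   the nonzero constant [c]. *)
exists (- 1, n%:R^-1 *: 'X) => /=.
rewrite derivB derivC subr0 derivXn -scaler_nat -scalerAl -scalerAr scalerA mulVf // scale1r.
rewrite -exprS prednK // mulN1r opprB subrK.
by rewrite polyC_eqp1.
Qed.

Lemma ex_root n c : (0 < n)%N -> exists r, r ^+ n == c.
Proof.
move=> n_gt0; have := size_Xn_roots c n_gt0; have := fun r => mem_Xn_roots c r n_gt0.
case: (Xn_roots n c) => [_ /= e|r rs /(_ r)]; first by rewrite -e in n_gt0.
by rewrite mem_head => /esym; exists r.
Qed.

End Roots.

(** * Labels of simple functors, the bijection and the count *)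

Section Classification.
Variables (F : closedFieldType) (m : nat) (X Y : finType).
Local Notation G := 'I_m.+1.
Variables (w : G -> G -> G -> F) (actX : G -> X -> X) (actY : G -> Y -> Y).
Variables (PsiX : G -> G -> X -> F) (PsiY : G -> G -> Y -> F).
Hypotheses (hX : is_Gset actX) (hY : is_Gset actY).
Hypotheses (hPX : is_modcat_Psi w actX PsiX) (hPY : is_modcat_Psi w actY PsiY).
Variable rep : {set X * Y} -> X * Y.
Hypothesis hrep : forall Gam, Gam \in diag_orbits actX actY -> rep Gam \in Gam.

Local Notation gamma := (@gammaXY F m.+1 X Y actX actY PsiX PsiY).
Local Notation orb := (diag_orbit actX actY).
Local Notation orbs := (diag_orbits actX actY).
Local Notation simple := (mf_simple actY PsiX PsiY).
Local Notation omodel := (omodel PsiX PsiY hX hY).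
Implicit Types (M N : modfun F Y actX) (Gam : {set X * Y}).

Lemma orb_rep Gam : Gam \in orbs -> orb (rep Gam) = Gam.
Proof.
move=> GamO; have := hrep GamO; case/imsetP: GamO => z _ ->; exact: diag_orbit_eq.
Qed.

Lemma splitting_Xn c : exists rs : seq F, 'X^(m.+1) - c%:P = \prod_(r <- rs) ('X - r%:P).
Proof. by exists (Xn_roots m.+1 c); rewrite Xn_rootsE. Qed.

Definition classified M (p : {set X * Y} * F) :=
  [/\ p.1 \in orbs, p.2 ^+ m.+1 = gamma (rep p.1) & mf_iso (omodel (rep p.1) p.2) M].

Lemma simple_classified M : simple M -> exists p, classified M p.
Proof.
move=> /(simple_omodel hX hY hPX hPY splitting_Xn) [z [xi [xi_n iso]]].
have zO : orb z \in orbs by apply/imsetP; exists z.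
exists (orb z, xi); split=> //=.
  by rewrite xi_n -(gamma_orbit hX hY hPX hPY (hrep zO)).
apply: mf_iso_trans iso; apply: omodel_rebase; exact/esym/orb_rep.
Qed.

(** A label is not unique, only its orbit and a power of its scalar are; [epsilon] picks one, the
    pair [(set0, 0)] merely showing that the type is inhabited. *)
Definition mf_class M : {set X * Y} * F := epsilon (inhabits (set0, 0)) (classified M).

Lemma mf_classP M : simple M -> classified M (mf_class M).
Proof. by move/simple_classified; apply: epsilon_spec. Qed.

(** Stated for arbitrary labels, so that the choice made in [mf_class] is harmless and the count can
    use labels of its own. *)
Lemma classified_iso M N p q : classified M p -> classified N q ->
  (mf_iso M N <-> p.1 = q.1 /\ p.2 ^+ #|p.1| = q.2 ^+ #|q.1|).
Proof.
move=> [pO p_n Mp] [qO q_n Nq]; split=> [MN|[e1 e2]].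
  have iso := mf_iso_trans (mf_iso_trans Mp MN) (mf_iso_sym Nq).
  have [] := omodel_iso_inv hPX hPY q_n p_n iso; rewrite !orb_rep // => e1 e2.
  by rewrite e1.
apply: mf_iso_trans (mf_iso_sym Mp) (mf_iso_trans _ Nq).
rewrite -e1; apply: (omodel_iso hX hY hPX hPY) => //; first by rewrite e1.
by rewrite orb_rep // e2 e1.
Qed.

Lemma omodel_classified Gam xi : Gam \in orbs -> xi ^+ m.+1 = gamma (rep Gam) ->
  simple (omodel (rep Gam) xi) /\ classified (omodel (rep Gam) xi) (Gam, xi).
Proof.
move=> GamO xi_n; split; first exact: (omodel_simple hX hY hPX hPY splitting_Xn).
by split=> //; exists (mfid _); split; [exact: mfid_mfmor | exists (mfid _); split;
  [exact: mfid_mfmor | split=> V; rewrite /mfid mulmx1]].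
Qed.

Lemma card_orb_dvd Gam : Gam \in orbs -> (0 < #|Gam|)%N && (#|Gam| %| m.+1)%N.
Proof.
by case/imsetP => z _ ->; rewrite (card_diag_orbit hX hY) order_gt0 order_rot_dvd.
Qed.

Lemma classification :
  (exists Phi : modfun F Y actX -> {set X * Y} * F,
     (forall M, simple M -> (Phi M).1 \in orbs /\ (Phi M).2 ^+ m.+1 = gamma (rep (Phi M).1)) /\
     (forall M N, simple M -> simple N ->
        (mf_iso M N <-> ((Phi M).1 = (Phi N).1 /\
            (Phi M).2 ^+ #|(Phi M).1| = (Phi N).2 ^+ #|(Phi N).1|))) /\
     (forall Gam (xi : F), Gam \in orbs -> xi ^+ m.+1 = gamma (rep Gam) ->
        exists M, simple M /\ (Phi M).1 = Gam /\ (Phi M).2 ^+ #|Gam| = xi ^+ #|Gam|)).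
Proof.
exists mf_class; split; [|split].
- by move=> M /mf_classP [].
- by move=> M N /mf_classP cM /mf_classP cN; apply: classified_iso.
move=> Gam xi GamO xi_n; have [sM cM] := omodel_classified GamO xi_n.
exists (omodel (rep Gam) xi); split=> //; have cM' := mf_classP sM.
have [|/= e1 e2] := (classified_iso cM' cM).1.
  by have [_ _ iso] := cM; apply: mf_iso_trans (mf_iso_sym iso) iso.
by rewrite -e2 e1.
Qed.

(** Over an orbit of size [r], the invariant [rho = xi ^+ r] runs through the roots of [gammaXY] of
    order [m.+1 %/ r]; in characteristic zero these are [m.+1 %/ r] distinct values. *)
Lemma simple_count : [pchar F] =i pred0 ->
  exists (N : nat) (Ms : 'I_N -> modfun F Y actX),
       (forall i, simple (Ms i)) /\
       (forall i j, mf_iso (Ms i) (Ms j) -> i = j) /\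
       (forall M, simple M -> exists i, mf_iso M (Ms i)) /\
       N = (\sum_(Gam in orbs) (m.+1 %/ #|Gam|))%N.
Proof.
move=> char0.
pose rhos Gam := Xn_roots (m.+1 %/ #|Gam|) (gamma (rep Gam)).
pose L := [seq (Gam, rho) | Gam <- enum orbs, rho <- rhos Gam].
have q_gt0 Gam : Gam \in orbs -> (0 < m.+1 %/ #|Gam|)%N.
  by move=> /card_orb_dvd /andP[r_gt0 rm]; rewrite divn_gt0 // dvdn_leq.
(* The implication sits inside the existential so that [xi] becomes a total function; its value
   outside [L] is arbitrary. *)
have xi_ex p : exists xi : F, p \in L -> xi ^+ #|p.1| = p.2.
  case: (boolP (p \in L)) => [/allpairsPdep [Gam [rho [GamO _ ->]]]|_]; last by exists 0.
  rewrite mem_enum in GamO; have /andP[r_gt0 _] := card_orb_dvd GamO.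
  by have [xi /eqP e] := ex_root rho r_gt0; exists xi.
have [xi xiE] : exists xi : {set X * Y} * F -> F, forall p, p \in L -> xi p ^+ #|p.1| = p.2.
  by exists (fun p => epsilon (inhabits 0) (fun x => p \in L -> x ^+ #|p.1| = p.2)) => p;
    apply: (epsilon_spec (inhabits 0) (fun x => p \in L -> x ^+ #|p.1| = p.2)).
have LP p : p \in L -> p.1 \in orbs /\ xi p ^+ m.+1 = gamma (rep p.1).
  move=> pL; have := xiE p pL; case/allpairsPdep: pL => Gam [rho [GamO]]; rewrite mem_enum in GamO.
  move=> rhoG -> /= e; split=> //; have /andP[_ rm] := card_orb_dvd GamO.
  move: rhoG; rewrite mem_Xn_roots ?q_gt0 // => /eqP <-.
  by rewrite -[rho in RHS]e -exprM mulnC divnK.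
pose p0 : {set X * Y} * F := (set0, 0).
pose Ms (i : 'I_(size L)) := omodel (rep (nth p0 L i).1) (xi (nth p0 L i)).
have MsP (i : 'I_(size L)) : simple (Ms i) /\ classified (Ms i) ((nth p0 L i).1, xi (nth p0 L i)).
  by have [O e] := LP _ (mem_nth p0 (ltn_ord i)); apply: omodel_classified.
have L_uniq : uniq L.
  apply: allpairs_uniq_dep; first exact: enum_uniq.
    move=> Gam; rewrite mem_enum => GamO; apply: uniq_Xn_roots.
      by rewrite (pcharf0P _).1 // -lt0n q_gt0.
    exact: (gamma_neq0 hPX hPY).
  by move=> [a b] [c d] _ _ /= [-> ->].
exists (size L), Ms; split; [|split; [|split]].
- by move=> i; case: (MsP i).
- move=> i j /(classified_iso (MsP i).2 (MsP j).2) /= [e1 e2].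
  apply: val_inj => /=; apply/eqP; rewrite -(nth_uniq p0 _ _ L_uniq) //.
  rewrite [nth p0 L i]surjective_pairing [nth p0 L j]surjective_pairing -!xiE ?mem_nth //.
  by rewrite e2 e1.
- move=> M /mf_classP cM; have [O e iso] := cM; set Gam := (mf_class M).1 in O e iso.
  have /andP[_ rm] := card_orb_dvd O.
  pose p := (Gam, (mf_class M).2 ^+ #|Gam|).
  have pL : p \in L.
    apply/allpairsPdep; exists Gam, p.2; split; rewrite ?mem_enum //.
    by rewrite mem_Xn_roots ?q_gt0 // -exprM mulnC divnK // e.
  have lt : (index p L < size L)%N by rewrite index_mem.
  exists (Ordinal lt); apply/(classified_iso cM (MsP (Ordinal lt)).2).
  by rewrite /= nth_index //= xiE.
rewrite size_allpairs_dep sumnE big_map -big_enum /=; apply: eq_big_seq => Gam.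
by rewrite mem_enum => GamO; rewrite size_Xn_roots ?q_gt0.
Qed.

End Classification.

Theorem theorem5p22 (F : closedFieldType) (n : nat) (hn : (0 < n)%N)
  (w : 'I_n.-1.+1 -> 'I_n.-1.+1 -> 'I_n.-1.+1 -> F)
  (X Y : finType) (actX : 'I_n.-1.+1 -> X -> X) (actY : 'I_n.-1.+1 -> Y -> Y)
  (PsiX : 'I_n.-1.+1 -> 'I_n.-1.+1 -> X -> F) (PsiY : 'I_n.-1.+1 -> 'I_n.-1.+1 -> Y -> F)
  (hw : normalized_3cocycle w)
  (hX : is_Gset actX) (hY : is_Gset actY)
  (hPX : is_modcat_Psi w actX PsiX) (hPY : is_modcat_Psi w actY PsiY)
  (rep : {set X * Y} -> X * Y)
  (hrep : forall Gam, Gam \in diag_orbits actX actY -> rep Gam \in Gam) :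
  (exists Phi : @modfun F _ X Y actX -> {set X * Y} * F,
     (forall M, mf_simple actY PsiX PsiY M ->
        (Phi M).1 \in diag_orbits actX actY /\
        (Phi M).2 ^+ n = gammaXY actX actY PsiX PsiY (rep (Phi M).1)) /\
     (forall M N, mf_simple actY PsiX PsiY M -> mf_simple actY PsiX PsiY N ->
        (mf_iso M N <->
           ((Phi M).1 = (Phi N).1 /\
            (Phi M).2 ^+ #|(Phi M).1| = (Phi N).2 ^+ #|(Phi N).1|))) /\
     (forall (Gam : {set X * Y}) (xi : F), Gam \in diag_orbits actX actY ->
        xi ^+ n = gammaXY actX actY PsiX PsiY (rep Gam) ->
        exists M, mf_simple actY PsiX PsiY M /\ (Phi M).1 = Gam /\
                  (Phi M).2 ^+ #|Gam| = xi ^+ #|Gam|))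
  /\
  ([pchar F] =i pred0 ->
     exists (N : nat) (Ms : 'I_N -> @modfun F _ X Y actX),
       (forall i, mf_simple actY PsiX PsiY (Ms i)) /\
       (forall i j, mf_iso (Ms i) (Ms j) -> i = j) /\
       (forall M, mf_simple actY PsiX PsiY M -> exists i, mf_iso M (Ms i)) /\
       N = (\sum_(Gam in diag_orbits actX actY) (n %/ #|Gam|))%N).
Proof.
case: n hn => // m _ in w actX actY PsiX PsiY hw hX hY hPX hPY hrep *.
split; first exact: (classification hX hY hPX hPY hrep).
exact: (simple_count hX hY hPX hPY hrep).
Qed.
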